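(* Let $f(z)=z^3$, so that $f'(z)=3z^2$, and let $u(t,x)=\sqrt[3]{x}$ on $\mathbb{R}^2$. Then $f(u(t,x))=x$, so that $\partial_t u+\partial_x(f(u))=\partial_x x\equiv 1$; thus the continuous function identically $1$ is an Eulerian source. However $\gamma(t)\equiv 0$ is a characteristic of $u$ and $\frac{d}{dt}u(t,\gamma(t))\equiv 0\neq 1$: the Broad source is the Borel function $\mathfrak{g}(t,x)=\mathbf{1}_{\{x\neq 0\}}(t,x)$ and not the continuous function identically $1$. In particular, the continuous function identically $1$ is not the Lagrangian source for the Lagrangian parameterization $\chi:\mathbb{R}\times(-2,2)\to\mathbb{R}$ given by $$\chi(t,y)=\begin{cases}\bigl(t+\operatorname{artanh}(y-1)\bigr)^3 & \text{if } t\geq -\operatorname{artanh}(y-1),\ y\in(0,2),\\ 0 & \text{if } t< -\operatorname{artanh}(y-1),\ y\in(0,2),\end{cases}$$ together with $\chi(t,y)=-\chi(-t,-y)$ if $-2<y<0$, and $\chi(t,0)=0$ for all $t$. In the half-plane $x>0$, setting $y=1-\tanh t_0$ and $s=t-t_0$, the characteristic curves are $s\mapsto(t_0+s,\,s^3)$ with $t_0\in\mathbb{R}$, $s>0$, and along the corresponding characteristic $\gamma_{t_0}(t)=(t-t_0)^3$ one has $u(t,\gamma_{t_0}(t))=\sqrt[3]{(t-t_0)^3}=t-t_0$.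
   Context: A characteristic of $u$ is a $C^1$ function $\gamma:I\to\mathbb{R}$ ($I$ an interval) with $\dot\gamma(t)=f'(u(t,\gamma(t)))$; the associated characteristic curve is $t\mapsto(t,\gamma(t))$. An Eulerian source is a Borel function $\mathfrak{g}$ on $\mathbb{R}^2$ with $\partial_t u+\partial_x(f(u))=\mathfrak{g}$ in $\mathcal{D}'(\mathbb{R}^2)$. A Broad source is a Borel function $\mathfrak{g}$ such that $\frac{d}{dt}u(t,\gamma(t))=\mathfrak{g}(t,\gamma(t))$, in the sense of distributions, for every characteristic $\gamma$. A Lagrangian parameterization associated with $u$ is a continuous function $(t,y)\mapsto\chi(t,y)\in\mathbb{R}$, with $t\in\mathbb{R}$ and $y$ ranging in an open interval (here $(-2,2)$), such that: for each $y$, $t\mapsto\chi(t,y)$ is a characteristic; for each $t$, $y\mapsto\chi(t,y)$ is nondecreasing; the map $(t,y)\mapsto(t,\chi(t,y))$ is onto $\mathbb{R}^2$. A Lagrangian source associated with $u$ and $\chi$ is a Borel function $\mathfrak{g}$ with $\frac{d}{dt}u(t,\chi(t,y))=\mathfrak{g}(t,\chi(t,y))$ in the sense of distributions in $t\in\mathbb{R}$, for every $y$. Here $\operatorname{artanh}$ is the inverse of $\tanh$, and $\mathbf{1}_A$ is the function equal to $1$ on $A$ and $0$ elsewhere. *)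

(* Defs.v *)
From HB Require Import structures.
From mathcomp Require Import all_boot all_order all_algebra.
From mathcomp Require Import all_classical all_reals all_analysis.

Set Implicit Arguments.
Unset Strict Implicit.
Unset Printing Implicit Defensive.

Import Order.TTheory GRing.Theory Num.Theory.
Import numFieldNormedType.Exports.

Local Open Scope classical_set_scope.
Local Open Scope ring_scope.

(* Points of the plane are pairs (t, x) : R * R, time first.  Measurability on
   R * R refers to the product of the Borel sigma-algebras, that is, the Borel
   sigma-algebra of the plane. *)

Section Distributions.
Context {R : realType}.

Definition iter_derive (V : normedModType R) (phi : V -> R) (vs : seq V) :
  V -> R := foldr (fun v psi => 'D_v psi) phi vs.

(* In finite dimension, having continuous iterated directional derivatives of
   all orders is the same as being C^oo; V is used below with R and R * R. *)
Definition smooth (V : normedModType R) (phi : V -> R) : Prop :=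
  forall vs : seq V,
    continuous (iter_derive phi vs) /\
    forall p v, derivable (iter_derive phi vs) p v.

Definition test_function (V : normedModType R) (Omega : set V)
    (phi : V -> R) : Prop :=
  let supp := closure [set p | phi p != 0] in
  [/\ smooth phi, compact supp & supp `<=` Omega].

(* Counterpart on R * R of the library's [locally_integrable]. *)
Definition locally_integrable2 (g : R * R -> R) : Prop :=
  measurable_fun setT g /\
  forall K : set (R * R), compact K ->
    (\int[(@lebesgue_measure R \x @lebesgue_measure R)%E]_(p in K)
       `|(g p)%:E| < +oo)%E.

(* dw/dt = h in D'(Omega), Omega open in R.  Both sides have to be
   distributions, hence the local integrability. *)
Definition distr_derive (Omega : set R) (w h : R -> R) : Prop :=
  [/\ locally_integrable Omega w,
      locally_integrable Omega h &
      forall phi : R -> R, test_function Omega phi ->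
        - (\int[lebesgue_measure]_(t in Omega) (w t * derive1 phi t)) =
        \int[lebesgue_measure]_(t in Omega) (h t * phi t)].

End Distributions.

Section Sources.
Context {R : realType}.
Implicit Types (f : R -> R) (u g chi : R * R -> R) (I J : interval R).

(* Derivative relative to I, thus one-sided at an endpoint belonging to I. *)
Definition has_derive_in I (gamma : R -> R) (t l : R) : Prop :=
  (gamma s - gamma t) / (s - t) @[s --> within [set` I] t^'] --> l.

(* Only the values of gamma on I matter. *)
Definition characteristic f u I (gamma : R -> R) : Prop :=
  exists dgamma : R -> R,
    [/\ {within [set` I], continuous dgamma},
        forall t, t \in I -> has_derive_in I gamma t (dgamma t) &
        forall t, t \in I -> dgamma t = derive1 f (u (t, gamma t))].

(* d_t u + d_x (f(u)) = g in D'(R^2). *)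
Definition eulerian_source f u g : Prop :=
  [/\ locally_integrable2 u,
      locally_integrable2 (f \o u),
      locally_integrable2 g &
      forall phi : R * R -> R, test_function setT phi ->
        - (\int[(@lebesgue_measure R \x @lebesgue_measure R)%E]_p
             (u p * 'D_((1, 0) : R * R) phi p))
        - (\int[(@lebesgue_measure R \x @lebesgue_measure R)%E]_p
             (f (u p) * 'D_((0, 1) : R * R) phi p)) =
        \int[(@lebesgue_measure R \x @lebesgue_measure R)%E]_p (g p * phi p)].

Definition broad_source f u g : Prop :=
  measurable_fun setT g /\
  forall I (gamma : R -> R), characteristic f u I gamma ->
    distr_derive (interior [set` I])
      (fun t => u (t, gamma t)) (fun t => g (t, gamma t)).

(* chi (t, y) is only relevant for y in the open interval J. *)
Definition lagrangian_parameterization f u J chi : Prop :=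
  open [set` J] /\
  [/\ {within setT `*` [set` J], continuous chi},
      forall y, y \in J -> characteristic f u `]-oo, +oo[ (fun t => chi (t, y)),
      forall t, {in J &, {homo (fun y => chi (t, y)) : y z / y <= z}} &
      set_surj (setT `*` [set` J]) setT (fun p => (p.1, chi p))].

Definition lagrangian_source u J chi g : Prop :=
  measurable_fun setT g /\
  forall y, y \in J ->
    distr_derive setT (fun t => u (t, chi (t, y))) (fun t => g (t, chi (t, y))).

End Sources.

Section Example.
Context {R : realType}.

Definition cbrt (x : R) : R := Num.sg x * (`|x| `^ (3%:R^-1)).

Definition tanh (x : R) : R :=
  (expR x - expR (- x)) / (expR x + expR (- x)).

(* Inverse function of tanh : R -> ]-1, 1[; junk value outside ]-1, 1[. *)
Definition artanh (y : R) : R := get [set x | tanh x = y].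

Definition flux (z : R) : R := z ^+ 3.

Definition u_cbrt (p : R * R) : R := cbrt p.2.

Definition chi_pos (t y : R) : R :=
  if - artanh (y - 1) <= t then (t + artanh (y - 1)) ^+ 3 else 0.

Definition chi (p : R * R) : R :=
  if 0 < p.2 then chi_pos p.1 p.2
  else if p.2 < 0 then - chi_pos (- p.1) (- p.2)
  else 0.

End Example.

(* Main.v *)
(** Along a characteristic gamma of u = cbrt x one has gamma' = 3 (cbrt gamma)^2,
    so w = cbrt (gamma t) satisfies w' = 1 wherever gamma does not vanish, and
    gamma is nondecreasing.  On a compact interval w is therefore
    max(0, t - q) + min(0, t - p) for some q and p, and integrating by parts on
    each piece shows that dw/dt is the indicator of [gamma != 0]: this is the
    Broad source.  It is unique because the functions exp(- 1 / (n q)),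
    q = (x - a)(b - x), extended by 0, are test functions increasing to the
    indicator of ]a, b[, so that two distributional derivatives have the same
    primitive and coincide almost everywhere by Lebesgue differentiation.
    Along gamma = 0 it vanishes, which excludes the source 1; since
    chi(t, 0) = 0, this also settles the Lagrangian claim.  For the Eulerian
    equation, d_t (cbrt(x) phi) and d_x (x phi) integrate to 0 along the lines
    x = const and t = const, and Fubini's theorem applies. *)

Require Import Defs.
From HB Require Import structures.
From mathcomp Require Import all_boot all_order all_algebra.
From mathcomp Require Import all_classical all_reals all_analysis.
From mathcomp Require Import measurable_realfun ring lra.
Import Order.TTheory GRing.Theory Num.Theory.
Import numFieldNormedType.Exports.
Local Open Scope classical_set_scope.
Local Open Scope ring_scope.

Set Implicit Arguments.
Unset Strict Implicit.
Unset Printing Implicit Defensive.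

(** * Cube root and hyperbolic tangent *)

Section CubeRoot.
Context {R : realType}.
Implicit Types x y : R.

Lemma cbrt_cube x : cbrt x ^+ 3 = x.
Proof.
rewrite /cbrt exprMn -(powR_mulrn 3 (powR_ge0 _ _)) -powRrM mulVf ?pnatr_eq0//.
rewrite powRr1// exprS expr2.
have [->|x0] := eqVneq x 0; first by rewrite normr0 mulr0.
by rewrite -expr2 sqr_sg x0 mulr1 -numEsg.
Qed.

(** The identity 4 (y^3 - x^3) = (y - x)^3 + 3 (y - x) (y + x)^2 displays the sign of the difference
    of cubes. *)
Lemma ler_cube : {mono (fun x : R => x ^+ 3) : x y / x <= y}.
Proof.
apply: le_mono => x y xy.
have d0 : 0 < y - x by rewrite subr_gt0.
have : 0 < (y - x) ^+ 3 by rewrite exprn_gt0.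
have : 0 <= (y - x) * (y + x) ^+ 2 by rewrite mulr_ge0 ?sqr_ge0 ?ltW.
lra.
Qed.

Lemma cube_cbrt x : cbrt (x ^+ 3) = x.
Proof. by apply: (inc_inj ler_cube); rewrite cbrt_cube. Qed.

Lemma ler_cbrt : {mono (@cbrt R) : x y / x <= y}.
Proof. by move=> x y; rewrite -ler_cube !cbrt_cube. Qed.

Lemma cbrt0 : cbrt 0 = 0 :> R.
Proof. by rewrite -[RHS]cube_cbrt expr0n. Qed.

Lemma cbrt_gt0 x : (0 < cbrt x) = (0 < x).
Proof. by rewrite -[in LHS]cbrt0 (leW_mono ler_cbrt). Qed.

Lemma cbrt_lt0 x : (cbrt x < 0) = (x < 0).
Proof. by rewrite -[in LHS]cbrt0 (leW_mono ler_cbrt). Qed.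

Lemma continuous_cbrt : continuous (@cbrt R).
Proof.
move=> x; apply/cvgrPdist_lt => /= e e0.
(* The same identity gives (u - v)^3 <= 4 (u^3 - v^3) for v <= u: the cube root is Hoelder of
   exponent 1/3, and this radius suffices. *)
apply/nbhs_ballP; exists (e ^+ 3 / 4) => /=; first by rewrite divr_gt0// exprn_gt0.
move=> y; rewrite /ball /=.
rewrite -{1}(cbrt_cube x) -{1}(cbrt_cube y) !ltr_norml.
set a := cbrt x; set b := cbrt y => /andP[h1 h2].
have H (u v : R) : u ^+ 3 - v ^+ 3 < e ^+ 3 / 4 -> u - v < e.
  move=> h; rewrite ltNge; apply/negP => le.
  have : e ^+ 3 <= (u - v) ^+ 3 by rewrite ler_cube.
  have : 0 <= (u - v) * (u + v) ^+ 2 by rewrite mulr_ge0 ?sqr_ge0// (le_trans _ le)// ltW.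
  lra.
by rewrite ltrNl opprB !H//; lra.
Qed.

Lemma is_derive_exprn n x : is_derive x 1 (fun z : R => z ^+ n) (n%:R * x ^+ n.-1).
Proof.
apply: DeriveDef; first exact: exprn_derivable.
by rewrite exp_derive /GRing.scale/= mulr1.
Qed.

Lemma is_derive_cbrt x : x != 0 -> is_derive x 1 (@cbrt R) (3 * cbrt x ^+ 2)^-1.
Proof.
move=> x0; rewrite -{1}(cbrt_cube x).
apply: (@is_derive_inverse _ (fun z : R => z ^+ 3)).
- exact: (@filterE _ _ (nbhs_filter _) _ (@cube_cbrt)).
- exact: (@filterE _ _ (nbhs_filter _) _ (@exprn_continuous R 3)).
- exact: (is_derive_exprn 3).
- by rewrite mulf_neq0// sqrf_eq0; apply: contra_neq x0 => c0; rewrite -(cbrt_cube x) c0 expr0n.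
Qed.

End CubeRoot.

Section HyperbolicTangent.
Context {R : realType}.
Implicit Types x y v : R.

(** A single exponential remains, in an increasing denominator greater than 1, so monotonicity and
    the bounds -1 and 1 can be read off. *)
Lemma tanhE x : tanh x = 1 - 2 / (expR (x *+ 2) + 1).
Proof.
have e0 := expR_gt0 x; have e1 := expR_gt0 (- x).
have e2 : expR (x *+ 2) = expR x ^+ 2 by rewrite -mulr_natl expRM_natl.
rewrite /tanh e2 expRN; field.
by rewrite gt_eqF/= ?gt_eqF//; nra.
Qed.

Lemma tanh_itv x : -1 < tanh x < 1.
Proof.
have e0 := expR_gt0 (x *+ 2).
have e1 : 0 < expR (x *+ 2) + 1 by rewrite addr_gt0.
rewrite tanhE ltrBrDl -ltrBrDr ltr_pdivrMr// gtrBl divr_gt0// andbT.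
lra.
Qed.

Lemma ltr_tanh : {mono (@tanh R) : x y / x < y}.
Proof.
apply: leW_mono; apply: le_mono => x y xy.
rewrite !tanhE ltrD2l ltrN2 ltr_pM2l// ltf_pV2 ?posrE ?addr_gt0 ?expR_gt0//.
by rewrite ltrD2r ltr_expR ltr_pMn2r.
Qed.

Lemma tanh_inj : injective (@tanh R).
Proof.
move=> x y /eqP; apply: contraTeq; rewrite neq_lt -(ltr_tanh x y) -(ltr_tanh y x) => /orP[] h.
  by rewrite lt_eqF.
by rewrite gt_eqF.
Qed.

(** [artanh] chooses some preimage under [tanh]; injectivity leaves only one candidate. *)
Lemma tanhK : cancel (@tanh R) artanh.
Proof.
by move=> x; apply: tanh_inj; apply: (@getPex _ [set y | tanh y = tanh x]); exists x.
Qed.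

Lemma tanh_half_ln v : -1 < v < 1 -> tanh (ln ((1 + v) / (1 - v)) / 2) = v.
Proof.
move=> /andP[v1 v2]; have v3 : 0 < 1 - v by lra.
set L := ln _; have L2 : L / 2 *+ 2 = L by field.
rewrite tanhE L2 lnK; last by rewrite posrE divr_gt0//; lra.
by field; rewrite gt_eqF//= -[X in X != 0]/(1 + v + (1 - v)) gt_eqF//; lra.
Qed.

(** The closed form replaces the choice made in [artanh] by an expression whose continuity follows
    from that of [ln]. *)
Lemma artanh_lnE v : -1 < v < 1 -> artanh v = ln ((1 + v) / (1 - v)) / 2.
Proof. by move=> /tanh_half_ln {1}<-; rewrite tanhK. Qed.

Lemma artanhK v : -1 < v < 1 -> tanh (artanh v) = v.
Proof.
by move=> v1; rewrite artanh_lnE// tanh_half_ln.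
Qed.

Lemma ler_artanh x y : -1 < x < 1 -> -1 < y < 1 -> x <= y -> artanh x <= artanh y.
Proof. by move=> x1 y1; rewrite !leNgt -(ltr_tanh (artanh y)) !artanhK. Qed.

Lemma continuous_artanh v : -1 < v < 1 -> {for v, continuous (@artanh R)}.
Proof.
move=> v1.
have nv : \forall z \near v, ln ((1 + z) / (1 - z)) / 2 = artanh z.
  have : v \in `]-1, 1[ by rewrite in_itv.
  move/near_in_itvoo; apply: filterS => z; rewrite in_itv/= => z1.
  by rewrite artanh_lnE.
rewrite /prop_for /continuous_at (artanh_lnE v1).
apply: cvg_trans; first exact: near_eq_cvg nv.
have v3 : 0 < 1 - v by case/andP: v1 => _; rewrite subr_gt0.
have v4 : 0 < 1 + v by case/andP: v1 => + _; lra.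
apply: cvgM; last exact: cvg_cst.
apply: (@cvg_comp _ _ _ (fun z => (1 + z) / (1 - z)) (@ln R) _ (nbhs ((1 + v) / (1 - v)))).
  apply: cvgM; first by apply: cvgD; [exact: cvg_cst|exact: cvg_id].
  apply: cvgV; first by rewrite gt_eqF.
  by apply: cvgB; [exact: cvg_cst|exact: cvg_id].
by apply: continuous_ln; rewrite divr_gt0.
Qed.

End HyperbolicTangent.

(** * Smooth bump functions *)

Section FlatFunctions.
Context {R : realType}.

(** The difference quotient at x0 is bounded by [|h| * k (h + x0)], which tends to 0. This settles
    the points where a piecewise formula is flat: those outside the open interval of a bump, and
    those up to the corner of a cubed positive part. *)
Lemma is_derive_sqr_bound (f k : R -> R) (x0 : R) : f x0 = 0 ->
  (forall x, `|f x| <= (x - x0) ^+ 2 * k x) -> {for x0, continuous k} ->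
  is_derive x0 1 f 0.
Proof.
move=> f0 fk ck.
suff C : h^-1 *: (f (h *: 1 + x0) - f x0) @[h --> 0^'] --> (0 : R).
  by apply: DeriveDef; [apply/cvg_ex; exists 0|exact/cvg_lim].
apply/norm_cvg0P.
have cb : `|h| * k (h + x0) @[h --> 0^'] --> (0 : R).
  have : {for 0, continuous (fun h : R => `|h| * k (h + x0))}.
    apply: cvgM; first by apply: cvg_norm; exact: cvg_id.
    apply: (@continuous_comp _ _ _ (fun h => h + x0) k 0); last by rewrite add0r.
    by apply: cvgD; [exact: cvg_id|exact: cvg_cst].
  by rewrite /prop_for /continuous_at normr0 mul0r => /cvg_within_filter; exact.
apply: (@squeeze_cvgr _ _ _ _ (cst 0) _ _ _ 0 _ cb); [|exact: cvg_cst].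
near=> h.
have h0 : h != 0 by near: h; exact: nbhs_dnbhs_neq.
rewrite normr_ge0 /= f0 subr0 normrZ [h *: 1]mulr1 normfV.
rewrite ler_pdivrMl ?normr_gt0// (le_trans (fk _))// addrK mulrA -expr2.
by rewrite real_normK// num_real.
Unshelve. all: by end_near. Qed.

Lemma derive_mul (f : R -> R) (x l v : R) : is_derive x 1 f l ->
  is_derive x v f (v * l).
Proof.
move=> fl; have df : differentiable f x by apply/derivable1_diffP; exact: ex_derive.
apply: DeriveDef; first exact: diff_derivable.
rewrite deriveE// -[v in LHS]mulr1 -[v * 1]/(v *: 1) linearZ/= -deriveE//.
by rewrite derive_val.
Qed.

Lemma is_derive_mull (f : R -> R) (x k l : R) : is_derive x 1 f l ->
  is_derive x 1 (fun y => k * f y) (k * l).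
Proof. by move=> fl; exact: is_deriveZ. Qed.

Lemma is_derive_mulr (f g : R -> R) (x k l : R) : is_derive x 1 f k ->
  is_derive x 1 g l -> is_derive x 1 (fun y => f y * g y) (f x * l + g x * k).
Proof. by move=> fk gl; exact: is_deriveM. Qed.

End FlatFunctions.

Section Bump.
Context {R : realType}.
Variables (a b c : R).
Hypothesis c0 : 0 < c.
Implicit Types (p : {poly R}) (x : R).

Let Q : {poly R} := ('X - a%:P) * (b%:P - 'X).

Let QE x : Q.[x] = (x - a) * (b - x).
Proof. by rewrite /Q !hornerE. Qed.

(* The product is positive exactly on ]a, b[; the family is closed under
   differentiation, which raises m by 2. *)
Definition bump (m : nat) p x : R :=
  if 0 < (x - a) * (b - x)
  then p.[x] * ((x - a) * (b - x))^-1 ^+ m * expR (- (c * ((x - a) * (b - x))^-1))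
  else 0.

Let dQ : {poly R} := (a + b)%:P - 'X *+ 2.

(** Write q for the product and q' for its derivative [dQ]. The derivative of p q^(-m) exp(- c / q)
    is this polynomial times q^(-m-2) exp(- c / q). *)
Definition bump_deriv_poly (m : nat) p : {poly R} :=
  p^`() * Q ^+ 2 - m%:R *: (p * dQ * Q) + c *: (p * dQ).

(** Keeping only the term of order m + 2 in the series of exp(c / q) yields q^(-m) exp(- c / q) <= K
    m q^2; the factor q^2 is what flatness requires. *)
Let K (m : nat) : R := (m.+2)`!%:R / c ^+ m.+2.

Let K_ge0 (m : nat) : 0 <= K m.
Proof. by rewrite divr_ge0// exprn_ge0// ltW. Qed.

Let flat_bound (m : nat) (q : R) : 0 < q ->
  q^-1 ^+ m * expR (- (c * q^-1)) <= K m * q ^+ 2.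
Proof.
move=> q0; have cq : 0 <= c / q by rewrite ltW// divr_gt0.
have h := expR_ge1Dxn m.+1 cq.
have h1 : (c / q) ^+ m.+2 / (m.+2)`!%:R <= expR (c / q) by apply: le_trans h; rewrite lerDr.
have f0 : 0 < (m.+2)`!%:R :> R by rewrite ltr0n fact_gt0.
rewrite expRN ler_pdivrMr ?expR_gt0//.
apply: le_trans (_ : K m * q ^+ 2 * ((c / q) ^+ m.+2 / (m.+2)`!%:R) <= _); last first.
  by rewrite ler_wpM2l// mulr_ge0 ?sqr_ge0// divr_ge0 ?ltW// exprn_gt0.
rewrite le_eqVlt; apply/orP; left; apply/eqP.
rewrite /K expr_div_n -(addn2 m) !exprD exprVn; field.
by rewrite !expf_neq0 ?gt_eqF.
Qed.

Lemma is_derive_bump (m : nat) p x :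
  is_derive x 1 (bump m p) (bump m.+2 (bump_deriv_poly m p) x).
Proof.
rewrite {2}/bump; case: ifPn => [q0|]; last first.
  rewrite -leNgt => q0.
  (* With q(z) = (z - a)(b - z), one has q(y) = q(x) + (y - x)(a + b - x - y) and q(x) <= 0. Hence
     q(y)^2 <= (y - x)^2 (a + b - x - y)^2 wherever q(y) > 0, and [flat_bound] provides the rest of
     the bound. *)
  apply: (@is_derive_sqr_bound _ _ (fun y => `|p.[y]| * K m * (a + b - x - y) ^+ 2)).
  - by rewrite /bump ltNge q0.
  - move=> y; rewrite /bump; case: ifPn => [qy|_]; last first.
      by rewrite normr0 mulr_ge0 ?sqr_ge0 // mulr_ge0 ?sqr_ge0 // mulr_ge0 ?K_ge0.
    rewrite -mulrA normrM (ger0_norm (mulr_ge0 _ (expR_ge0 _))); last first.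
      by rewrite exprn_ge0// invr_ge0 ltW.
    apply: le_trans (_ : `|p.[y]| * (K m * ((y - a) * (b - y)) ^+ 2) <= _).
      by rewrite ler_wpM2l// flat_bound.
    have -> : (y - x) ^+ 2 * (`|p.[y]| * K m * (a + b - x - y) ^+ 2) =
        `|p.[y]| * (K m * ((y - x) * (a + b - x - y)) ^+ 2) by ring.
    rewrite ler_wpM2l// (ler_wpM2l (K_ge0 m))//.
    by rewrite ler_sqr ?nnegrE; [nra|exact: ltW|nra].
  - apply: cvgM; first apply: cvgM; last 2 first.
    + exact: cvg_cst.
    + apply: (@continuous_comp _ _ _ (fun y => a + b - x - y) (fun z => z ^+ 2)); last exact: exprn_continuous.
      by apply: cvgB; [exact: cvg_cst|exact: cvg_id].
    + by apply: cvg_norm; exact: continuous_horner.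
(* Positivity of the product persists near x, so there the explicit formula can be differentiated by
   the usual rules. *)
have nz : \forall y \near x, p.[y] * (Q.[y])^-1 ^+ m * expR (- (c * Q.[y]^-1)) = bump m p y.
  have cQ : {for x, continuous (horner Q)} by exact: continuous_horner.
  have : 0 < Q.[x] by rewrite QE.
  by move/(cvgr_gt _ cQ); apply: filterS => y; rewrite /bump QE => ->.
apply: (near_eq_is_derive nz).
have hp (P : {poly R}) : is_derive x 1 (horner P) P^`().[x].
  by apply: DeriveDef; [exact: derivable_horner|rewrite -derive1E -derivE].
have dQE : Q^`() = dQ by rewrite /Q /dQ derivM !derivB !derivX !derivC polyCD; ring.
have Qx : Q.[x] != 0 by rewrite QE gt_eqF.
have hV : is_derive x 1 (fun y => Q.[y]^-1) (- (Q.[x]^-1) ^+ 2 * dQ.[x]).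
  by rewrite -dQE exprVn; exact: is_deriveV.
have hX : is_derive x 1 (fun y => Q.[y]^-1 ^+ m) (- m%:R * Q.[x]^-1 ^+ m.+1 * dQ.[x]).
  apply: (is_derive_eq (@is_derive1_comp _ (fun z => z ^+ m) _ _ _ _ (is_derive_exprn m _) hV)).
   case: m {nz} => [|m' /=]; first by rewrite !(mul0r,oppr0).
  by rewrite !exprS; ring.
have hE : is_derive x 1 (fun y => expR (- (c * Q.[y]^-1)))
    (expR (- (c * Q.[x]^-1)) * (c * Q.[x]^-1 ^+ 2 * dQ.[x])).
  apply: (@is_derive1_comp _ expR (fun y => - (c * Q.[y]^-1))).
  under eq_fun do rewrite -mulNr.
  by apply: (is_derive_eq (is_derive_mull (- c) hV)); ring.
apply: (is_derive_eq (is_derive_mulr (is_derive_mulr (hp p) hX) hE)).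
have -> : (bump_deriv_poly m p).[x] =
    p^`().[x] * Q.[x] ^+ 2 - m%:R * (p.[x] * dQ.[x] * Q.[x]) + c * (p.[x] * dQ.[x]).
  by rewrite /bump_deriv_poly !(hornerD, hornerN, hornerZ, hornerM, horner_exp).
rewrite -QE -(addn2 m) exprD (exprS _ m).
move: (Q.[x]) (dQ.[x]) (_ ^+ m) (expR _) Qx => q d r e q0'.
by field.
Qed.

End Bump.

(** * Bumps as test functions *)

Section BumpTestFunction.
Context {R : realType}.
Implicit Types (a b c : R) (D : set R).

(** By induction each iterated derivative is again a [bump], with another exponent and polynomial; a
    direction v only rescales the polynomial. *)
Lemma smooth_bump a b c m p : 0 < c -> smooth (bump a b c m p : R -> R).
Proof.
move=> c0 vs.
have [k [q ->]] : exists k q, iter_derive (bump a b c m p) vs = bump a b c k q.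
  elim: vs => [|v vs [k [q IH]]]; first by exists m, p.
  exists k.+2, (v *: bump_deriv_poly a b c k q); apply/funext => x /=.
  rewrite IH (@derive_val _ _ _ _ _ _ _ (derive_mul v (is_derive_bump a b c0 k q x))).
  by rewrite /bump hornerZ; case: ifP => _; [rewrite !mulrA|rewrite mulr0].
split.
  move=> x; apply: differentiable_continuous; apply/derivable1_diffP.
  exact: (@ex_derive _ _ _ _ _ _ _ (is_derive_bump a b c0 k q x)).
by move=> x v; exact: (@ex_derive _ _ _ _ _ _ _ (derive_mul v (is_derive_bump a b c0 k q x))).
Qed.

(** The order of a and b matters: for b < a the product would be positive on []b, a[]. *)
Lemma in_itvoo_prod_gt0 a b x : a <= b -> (x \in `]a, b[) = (0 < (x - a) * (b - x)).
Proof.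
move=> ab; rewrite in_itv /=; apply/idP/idP => [/andP[ax xb]|h].
  by rewrite mulr_gt0 ?subr_gt0.
apply/andP; split; nra.
Qed.

Lemma bump_out a b c m p x : a <= b -> x \notin `]a, b[ -> bump a b c m p x = 0.
Proof. by move=> ab; rewrite in_itvoo_prod_gt0// /bump => /negbTE ->. Qed.

Lemma test_function_bump a b c m p D : 0 < c -> a <= b -> `[a, b] `<=` D ->
  test_function D (bump a b c m p : R -> R).
Proof.
move=> c0 ab abD.
have sub : closure [set x | bump a b c m p x != 0] `<=` `[a, b].
  apply: (@subset_trans _ (closure `[a, b])); last exact: itv_closed.
  apply: closure_subset => x /=; apply: contra_neqT => h; apply: bump_out => //.
  by apply: contra h; rewrite !in_itv/= => /andP[/ltW -> /ltW ->].
split; first exact: smooth_bump.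
  by apply: subclosed_compact sub; [exact: closed_closure|exact: segment_compact].
exact: subset_trans sub abD.
Qed.

(** The parameter c = 1 / (n + 1) tends to 0, so the exponential tends to 1 wherever the product is
    positive. *)
Definition bump1 a b n : R -> R := bump a b (n.+1%:R^-1) 0 1.

Lemma bump1_bound a b n x : 0 <= bump1 a b n x <= 1.
Proof.
rewrite /bump1 /bump; case: ifPn => [h|_]; last by rewrite lexx ler01.
rewrite hornerC !mul1r expR_ge0/= expR_le1 oppr_le0 mulr_ge0 ?invr_ge0//.
exact: ltW.
Qed.

Lemma cvg_bump1 a b x : a <= b -> x \in `]a, b[ -> bump1 a b n x @[n --> \oo] --> (1 : R).
Proof.
move=> ab; rewrite in_itvoo_prod_gt0// => h.
rewrite /bump1 /bump h; under eq_fun do rewrite hornerC expr0 !mul1r.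
have C : - (n.+1%:R^-1 * ((x - a) * (b - x))^-1) @[n --> \oo] --> (0 : R).
  rewrite -[X in _ --> X]oppr0 -[X in _ --> - X](mul0r ((x - a) * (b - x))^-1).
  by apply: cvgN; apply: cvgM; [exact: cvg_harmonic|exact: cvg_cst].
apply: cvg_comp; first exact: C.
by have := @continuous_expR R 0; rewrite /continuous_at expR0.
Qed.

End BumpTestFunction.

(** * Uniqueness of distributional derivatives *)

Section DistributionalUniqueness.
Context {R : realType}.
Implicit Types (a b c : R) (D : set R) (h w : R -> R).
Local Notation mu := (@lebesgue_measure R).

Lemma locally_integrable_itv D h a b : locally_integrable D h ->
  `[a, b] `<=` D -> mu.-integrable `[a, b] (EFin \o h).
Proof.
move=> [mh oD ih] abD; apply/integrableP; split; last exact: ih (@segment_compact _ _ _).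
by apply/measurable_EFinP; apply: measurable_funS mh => //; exact: open_measurable.
Qed.

(** Dominated convergence on the open interval, with |h| as dominating function; the two endpoints
    form a null set. *)
Lemma cvg_Rintegral_bump1 D h a b : locally_integrable D h -> a <= b ->
  `[a, b] `<=` D ->
  \int[mu]_(x in D) (h x * bump1 a b n x) @[n --> \oo] --> \int[mu]_(x in `[a, b]) h x.
Proof.
move=> lh ab abD.
have ih := locally_integrable_itv lh abD.
have ih' : mu.-integrable `]a, b[ (EFin \o h).
  by apply: integrableS ih => //; exact: subset_itv_oo_cc.
have mh : measurable_fun `]a, b[ h by apply/measurable_EFinP; exact: measurable_int ih'.
have mb n : measurable_fun `]a, b[ (bump1 a b n).
  apply: measurable_funTS; apply: continuous_measurable_fun => x.
  have n0 : 0 < n.+1%:R^-1 :> R by rewrite invr_gt0.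
  by have /= [] := smooth_bump a b 0 1 n0 nil.
have E n : \int[mu]_(x in D) (h x * bump1 a b n x) = \int[mu]_(x in `]a, b[) (h x * bump1 a b n x).
  rewrite [LHS]Rintegral_mkcond [RHS]Rintegral_mkcond; congr Rintegral; apply/funext => x.
  rewrite !patchE; case: ifPn => [xD|]; case: ifPn => //.
    by rewrite notin_setE /= => /negP xab; rewrite /bump1 bump_out// mulr0.
  move=> /set_mem xab /negP[]; apply/mem_set/abD; exact: subset_itv_oo_cc xab.
under eq_fun do rewrite E.
have [|||||_ _ C] := @dominated_convergence _ _ _ mu `]a, b[ (measurable_itv _)
  (fun n (x : R) => (h x * bump1 a b n x)%:E) (EFin \o h) (fun x : R => `|h x|%:E).
- by move=> n; apply/measurable_EFinP; exact: (measurable_funM mh (mb n)).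
- exact: measurable_int ih'.
- apply: aeW => x xab; apply/fine_cvgP; split; first exact: nearW.
  rewrite -[X in _ --> X]mulr1; apply: cvgM; first exact: cvg_cst.
  exact: cvg_bump1.
- exact: (integrable_abse ih').
- apply: aeW => x n xab /=; rewrite lee_fin normrM ler_piMr//.
  by have /andP[b0 b1] := bump1_bound a b n x; rewrite ger0_norm.
have I : (\int[mu]_(x in `]a, b[) (h x)%:E)%E \is a fin_num by exact: integrable_fin_num.
rewrite -Rintegral_itv_obnd_cbnd; last first.
  by apply: integrableS ih => //; apply: subset_itvr; rewrite bnd_simp.
rewrite -Rintegral_itv_bndo_bndc//.
by apply: fine_cvg; rewrite fineK.
Qed.

(** The functions [bump1 a b n] are admissible tests, so two sequences of integrals agree term by
    term and have the same limit. *)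
Lemma Rintegral_itv_unique D h1 h2 a b : locally_integrable D h1 -> locally_integrable D h2 ->
  (forall phi : R -> R, test_function D phi ->
     \int[mu]_(x in D) (h1 x * phi x) = \int[mu]_(x in D) (h2 x * phi x)) ->
  `[a, b] `<=` D -> \int[mu]_(x in `[a, b]) h1 x = \int[mu]_(x in `[a, b]) h2 x.
Proof.
move=> l1 l2 h12 abD; have [ab|ba] := leP a b; last first.
  by rewrite set_itv_ge ?Rintegral_set0// bnd_simp -ltNge.
have c1 := cvg_Rintegral_bump1 l1 ab abD.
have c2 := cvg_Rintegral_bump1 l2 ab abD.
apply: (cvg_unique (@Rhausdorff R) c1); apply: cvg_trans c2.
apply: near_eq_cvg; apply: nearW => n; apply/esym/h12.
by apply: test_function_bump => //; rewrite invr_gt0.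
Qed.

(** Lebesgue differentiation recovers each function almost everywhere from its primitive, and the
    primitives of [h1] and [h2] coincide. *)
Lemma ae_eq_itv D h1 h2 a b : locally_integrable D h1 -> locally_integrable D h2 ->
  (forall phi : R -> R, test_function D phi ->
     \int[mu]_(x in D) (h1 x * phi x) = \int[mu]_(x in D) (h2 x * phi x)) ->
  `[a, b] `<=` D -> {ae mu, forall x, x \in `[a, b] -> h1 x = h2 x}.
Proof.
move=> l1 l2 h12 abD; have AF := ae_filter_ringOfSetsType mu.
have FE h : locally_integrable D h -> {ae mu, forall x, x \in `[a, b] ->
    derive1 (fun y => \int[mu]_(x in `[a, Num.min y b]) h x) x = h x}.
  move=> lh; have ih := locally_integrable_itv lh abD.
  (* Extended by 0 outside [[a, b]], h is integrable on the whole line, and its primitive from -oo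
     to y is the integral over [[a, Num.min y b]]. *)
  have ipT : mu.-integrable setT (EFin \o (h \_ `[a, b])).
    by rewrite -restrict_EFin; apply/(integrable_mkcond _ _).1.
  have lp : locally_integrable setT (h \_ `[a, b]) by apply: open_integrable_locally => //; exact: openT.
  have ip y : mu.-integrable `]-oo, y] (EFin \o (h \_ `[a, b])) by apply: integrableS ipT.
  have := FTC1Ny ip lp; apply: filterS => x [_ Dx] xab.
  rewrite -[RHS](_ : (h \_ `[a, b]) x = _); last by rewrite patchE mem_set.
  rewrite -Dx; congr (derive1 _ x); apply/funext => y.
  rewrite [LHS]Rintegral_mkcond [RHS]Rintegral_mkcond; congr Rintegral; apply/funext => z.
  rewrite !patchE !mem_setE !in_itv /= le_min.
  by case: (z <= y); rewrite ?andbT ?andbF.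
have := FE _ l1; have := FE _ l2; apply: filterS2 => x e2 e1 xab.
rewrite -(e1 xab) -(e2 xab); congr (derive1 _ x); apply/funext => y.
apply: (Rintegral_itv_unique l1 l2 h12); apply: subset_trans abD.
by apply: subset_itvl; rewrite bnd_simp ge_min lexx orbT.
Qed.

(** The open set D is covered by the countably many closed rational intervals that it contains, and
    a countable union of null sets is null. *)
Lemma ae_eq_open D h1 h2 : locally_integrable D h1 -> locally_integrable D h2 ->
  (forall phi : R -> R, test_function D phi ->
     \int[mu]_(x in D) (h1 x * phi x) = \int[mu]_(x in D) (h2 x * phi x)) ->
  {ae mu, forall x, D x -> h1 x = h2 x}.
Proof.
move=> l1 l2 h12; have [_ oD _] := l1; have AF := ae_filter_ringOfSetsType mu.
(* Pairs of rationals are enumerated by their codes; an n that codes no pair imposes no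
   condition. *)
pose P n x := forall q : rat * rat, unpickle n = Some q ->
  `[ratr q.1, ratr q.2] `<=` D -> x \in `[ratr q.1 : R, ratr q.2] -> h1 x = h2 x.
have := @ae_foralln _ _ _ mu P _.
have PA n : {ae mu, forall x, P n x}.
  case E : (unpickle n : option (rat * rat)) => [q|]; last first.
    by apply: aeW => x q; rewrite E.
  have [qD|qD] := pselect (`[ratr q.1, ratr q.2] `<=` D); last first.
    by apply: aeW => x q'; rewrite E => -[<-].
  have := ae_eq_itv l1 l2 h12 qD; apply: filterS => x hx q'.
  by rewrite E => -[<-] _; exact: hx.
move=> /(_ PA); apply: filterS => x Px Dx.
have : nbhs x D by exact: open_nbhs_nbhs.
move=> /nbhs_ballP[e /= e0 eD].
have [q1 /itvP q1P] := @rat_in_itvoo _ (x - e) x ltac:(by rewrite ltrBlDr ltrDl).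
have [q2 /itvP q2P] := @rat_in_itvoo _ x (x + e) ltac:(by rewrite ltrDl).
apply: (Px (pickle (q1, q2)) (q1, q2)); first by rewrite pickleK.
  move=> y /=; rewrite in_itv /= => /andP[y1 y2]; apply: eD.
  rewrite /ball/= ltr_distlC (lt_le_trans _ y1) ?q1P//=.
  by rewrite (le_lt_trans y2) ?q2P.
by rewrite in_itv/= !ltW ?q1P ?q2P.
Qed.

Lemma distr_derive_unique D w h1 h2 : distr_derive D w h1 -> distr_derive D w h2 ->
  {ae mu, forall x, D x -> h1 x = h2 x}.
Proof.
move=> [_ l1 d1] [_ l2 d2]; apply: ae_eq_open => // phi tphi.
by rewrite -d1// -d2.
Qed.

End DistributionalUniqueness.

(** * Characteristics *)

Section RelativeDerivative.
Context {R : realType}.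
Implicit Types (I : interval R) (gamma g : R -> R) (t l : R).

Lemma is_derive_slopeP g t l :
  is_derive t 1 g l <-> (g s - g t) / (s - t) @[s --> t^'] --> l.
Proof.
have E : (g s - g t) / (s - t) @[s --> t^'] = h^-1 *: (g (h *: 1 + t) - g t) @[h --> 0^'].
  rewrite eqEsubset; split => P /= /nbhs_ballP[e /= e0 eP]; apply/nbhs_ballP; exists e => //=.
    move=> h he h0; have := eP (h + t); rewrite /ball /= in he *.
    rewrite opprD addrCA subrr addr0 => /(_ _ _); rewrite addrK [h *: 1]mulr1 [_ *: _]mulrC; apply.
      by rewrite sub0r in he.
    by rewrite -subr_eq0 addrK.
  move=> s se st; have := eP (s - t); rewrite /ball /= in se *.
  rewrite sub0r opprB => /(_ se); rewrite subr_eq0 => /(_ st).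
  by rewrite [(s - t) *: 1]mulr1 subrK [_ *: _]mulrC.
rewrite E; split=> [[] /cvg_ex[k /= kC] <-|C].
  have -> // : 'D_1 g t = k by apply/cvg_lim.
by apply: DeriveDef; [apply/cvg_ex; exists l|exact/cvg_lim].
Qed.

Lemma is_derive_has_derive_in I g t l : is_derive t 1 g l -> has_derive_in I g t l.
Proof. by move=> /is_derive_slopeP C; apply: cvg_within_filter. Qed.

Lemma has_derive_in_interior I g t l : ([set` I])° t -> has_derive_in I g t l ->
  is_derive t 1 g l.
Proof.
move=> It C; apply/is_derive_slopeP; apply: cvg_trans C.
move=> P nP.
have F : Filter t^' by exact: dnbhs_filter.
by apply: (@filterS _ _ F _ _ _ (@filterI _ _ F _ _ (nbhs_dnbhs It) nP)) => s [sI]; exact.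
Qed.

(** Close to t the slope is within 1 of l, so |g s - g t| is at most (|l| + 1) |s - t|. *)
Lemma has_derive_in_cvg I g t l : has_derive_in I g t l ->
  g s @[s --> within [set` I] (nbhs t)] --> g t.
Proof.
move=> /cvgrPdist_lt /(_ 1 ltr01) /nbhs_ballP[e /= e0 eP].
apply/cvgrPdist_lt => /= r r0; apply/nbhs_ballP.
have k0 : 0 < `|l| + 1 by rewrite ltr_wpDl.
exists (Num.min e (r / (`|l| + 1))) => /=; first by rewrite lt_min e0 divr_gt0.
move=> s; rewrite /ball /= lt_min => /andP[se sr] Is.
have [->|st] := eqVneq s t; first by rewrite subrr normr0.
have st0 : 0 < `|s - t| by rewrite normr_gt0 subr_eq0.
have := eP s se st Is => h.
rewrite distrC in sr; rewrite distrC.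
rewrite ltr_pdivlMr// in sr; apply: le_lt_trans sr.
rewrite mulrC -ler_pdivrMr// -normfV -normrM.
rewrite -[X in `|X|](subrK l) addrC (le_trans (ler_normD _ _))// lerD2l ltW//.
by rewrite distrC.
Qed.

End RelativeDerivative.

Section Characteristics.
Context {R : realType}.
Implicit Types (I : interval R) (gamma : R -> R).
Local Notation char := (characteristic (@flux R) (@u_cbrt R)).

Lemma derive1_flux (z : R) : derive1 (@flux R) z = 3 * z ^+ 2.
Proof.
by have d := is_derive_exprn 3 z; rewrite derive1E (@derive_val _ _ _ _ _ _ _ d).
Qed.

Lemma char_deriveP I gamma : char I gamma -> forall t, t \in I ->
  has_derive_in I gamma t (3 * cbrt (gamma t) ^+ 2).
Proof.
move=> [dg [_ hd dE]] t tI; rewrite -derive1_flux -[cbrt _]/(u_cbrt (t, gamma t)).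
by rewrite -dE//; exact: hd.
Qed.

Lemma char_continuous I gamma : char I gamma -> {within [set` I], continuous gamma}.
Proof.
by move=> /char_deriveP hd; apply/subspace_continuousP => t tI; exact: has_derive_in_cvg (hd t tI).
Qed.

Lemma within_continuous_comp (A : set R) (f g : R -> R) : {within A, continuous g} ->
  continuous f -> {within A, continuous (f \o g)}.
Proof.
move=> /subspace_continuousP cg cf; apply/subspace_continuousP => x xA.
by apply: cvg_comp; [exact: cg x xA|exact: cf].
Qed.

Lemma char_is_derive I gamma a b t : char I gamma -> [set` `[a, b]] `<=` [set` I] ->
  t \in `]a, b[ -> is_derive t 1 gamma (3 * cbrt (gamma t) ^+ 2).
Proof.
move=> cg abI tab.
have tI : t \in I by apply: abI; exact: subset_itv_oo_cc tab.
apply: has_derive_in_interior (char_deriveP cg tI).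
have : \forall s \near t, s \in `]a, b[ by exact: near_in_itvoo.
by apply: filterS => s /subset_itv_oo_cc /abI.
Qed.

(** Away from 0 the chain rule multiplies 1 / (3 (cbrt gamma)^2) by 3 (cbrt gamma)^2, so
    [cbrt \o gamma] has derivative 1 and the mean value theorem concludes. *)
Lemma char_cbrt_affine I gamma a b : char I gamma -> [set` `[a, b]] `<=` [set` I] -> a <= b ->
  (forall t, t \in `[a, b] -> gamma t != 0) -> cbrt (gamma b) - cbrt (gamma a) = b - a.
Proof.
move=> cg abI; rewrite le_eqVlt => /predU1P[->|ab] g0; first by rewrite !subrr.
have cw : {within `[a, b], continuous (cbrt \o gamma)}.
  apply: within_continuous_comp; last exact: continuous_cbrt.
  exact: continuous_subspaceW abI (char_continuous cg).
have dw t : t \in `]a, b[ -> is_derive t 1 (cbrt \o gamma) 1.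
  move=> tab; have gt0 : gamma t != 0 by apply: g0; exact: subset_itv_oo_cc tab.
  apply: (is_derive_eq (is_derive1_comp (is_derive_cbrt gt0) (char_is_derive cg abI tab))).
  rewrite mulVf// mulf_neq0// expf_neq0//; apply: contra_neq gt0 => c0.
  by rewrite -(cbrt_cube (gamma t)) c0 expr0n.
by have [s _ /= ->] := MVT ab dw cw; rewrite mul1r.
Qed.

Lemma char_nondecreasing I gamma a b : char I gamma -> a \in I -> b \in I ->
  a <= b -> gamma a <= gamma b.
Proof.
move=> cg aI bI ab; have abI : [set` `[a, b]] `<=` [set` I].
  by move=> t /=; rewrite in_itv /=; exact: (@interval_is_interval _ I).
apply: (@ger0_derive1_le_cc _ gamma a b) => //; rewrite ?in_itv/= ?lexx ?ab//.
- by move=> t tab; have d := char_is_derive cg abI tab; exact: ex_derive.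
- move=> t tab; have d := char_is_derive cg abI tab.
  by rewrite derive1E (@derive_val _ _ _ _ _ _ _ d) mulr_ge0 ?sqr_ge0.
- exact: continuous_subspaceW abI (char_continuous cg).
Qed.

Lemma char_pos_cube I gamma : char I gamma -> (forall t, t \in I -> 0 < gamma t) ->
  exists t0, forall t, t \in I -> t0 < t /\ gamma t = (t - t0) ^+ 3.
Proof.
move=> cg g0; have [[t1 t1I]|I0] := pselect (exists t, t \in I); last first.
  by exists 0 => t tI; exfalso; apply: I0; exists t.
have A a b : a \in I -> b \in I -> a <= b -> cbrt (gamma b) - cbrt (gamma a) = b - a.
  move=> aI bI ab; have abI : [set` `[a, b]] `<=` [set` I].
    by move=> t /=; rewrite in_itv /=; exact: (@interval_is_interval _ I).
  by apply: (char_cbrt_affine cg abI ab) => t /abI /g0; rewrite lt_neqAle eq_sym => /andP[].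
(* The line of slope 1 through (t1, cbrt (gamma t1)) crosses 0 at this time. *)
exists (t1 - cbrt (gamma t1)) => t tI.
have E : cbrt (gamma t) = t - (t1 - cbrt (gamma t1)).
  by have [/(A _ _ tI t1I)|/ltW/(A _ _ t1I tI)] := leP t t1; lra.
by rewrite -E cbrt_cube -subr_gt0 -E cbrt_gt0; split => //; exact: g0.
Qed.

End Characteristics.

(** * The Broad source *)

Section PiecewiseAffine.
Context {R : realType}.
Implicit Types (w : R -> R) (c d : R).

(** The three hypotheses are what w = [cbrt \o gamma] inherits from a characteristic: it is
    nondecreasing, takes intermediate values and has slope 1 off its zeros. The positive and
    negative parts are treated apart because w may rest at 0 for some time in between. *)
Lemma pos_part_affine w c d :
  (forall a b, c <= a -> a <= b -> b <= d -> w a <= w b) ->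
  (forall a b v, c <= a -> a <= b -> b <= d -> w a <= v <= w b ->
     exists2 s, s \in `[a, b] & w s = v) ->
  (forall a b, c <= a -> a <= b -> b <= d ->
     (forall t, t \in `[a, b] -> w t != 0) -> w b - w a = b - a) ->
  exists q, forall t, c <= t <= d -> Num.max 0 (w t) = Num.max 0 (t - q).
Proof.
move=> mono ivt aff; have [wd|wd] := leP (w d) 0.
  exists d => t /andP[ct td].
  by rewrite !max_l ?subr_le0// (le_trans _ wd)// mono.
have A t : c <= t -> t <= d -> 0 < w t -> w t = t - (d - w d).
  move=> ct td wt; suff : w d - w t = d - t by lra.
  apply: aff => // s; rewrite in_itv/= => /andP[ts sd].
  by rewrite gt_eqF// (lt_le_trans wt)// mono.
(* Following the line of slope 1 backwards from (d, w d) gives the time q = d - w d at which w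
   leaves 0. *)
exists (d - w d) => t /andP[ct td].
have [wt|wt] := leP (w t) 0; last by rewrite -A// max_r// ltW.
rewrite max_l// subr_le0 leNgt; apply/negP => qt.
(* Suppose w t <= 0 although q < t. The small positive value v is attained at some s >= t, where w s
   = s - q >= t - q; but v <= (t - q) / 2. *)
pose v := Num.min ((t - (d - w d)) / 2) (w d).
have v0 : 0 < v by rewrite lt_min wd andbT divr_gt0// subr_gt0.
have [s] : exists2 s, s \in `[t, d] & w s = v.
  by apply: ivt => //; rewrite (le_trans wt (ltW v0)) ge_min lexx orbT.
rewrite in_itv/= => /andP[ts sd] ws.
have := A s (le_trans ct ts) sd; rewrite ws => /(_ v0).
have : v <= (t - (d - w d)) / 2 by rewrite ge_min lexx.
lra.
Qed.

(** Reflection through the origin: the positive case is applied to - w (- t) on [[- d, - c]]. *)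
Lemma neg_part_affine w c d :
  (forall a b, c <= a -> a <= b -> b <= d -> w a <= w b) ->
  (forall a b v, c <= a -> a <= b -> b <= d -> w a <= v <= w b ->
     exists2 s, s \in `[a, b] & w s = v) ->
  (forall a b, c <= a -> a <= b -> b <= d ->
     (forall t, t \in `[a, b] -> w t != 0) -> w b - w a = b - a) ->
  exists p, forall t, c <= t <= d -> Num.min 0 (w t) = Num.min 0 (t - p).
Proof.
move=> mono ivt aff.
have [|||q qP] := @pos_part_affine (fun t => - w (- t)) (- d) (- c).
- by move=> a b ca ab bd; rewrite lerN2 mono//; lra.
- move=> a b v ca ab bd /andP[av vb].
  have [||||s] := ivt (- b) (- a) (- v); try lra.
  rewrite in_itv/= => sab ws; exists (- s); last by rewrite opprK ws opprK.
  by rewrite in_itv/=; lra.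
- move=> a b ca ab bd w0; suff : w (- a) - w (- b) = (- a) - (- b) by lra.
  apply: aff; [lra..|] => t; rewrite in_itv/= => tab.
  by rewrite -oppr_eq0 -[t]opprK w0// in_itv/=; lra.
have minE (z : R) : Num.min 0 z = - Num.max 0 (- z) by rewrite oppr_max oppr0 opprK.
exists (- q) => t ctd; have := qP (- t); rewrite opprK !minE opprD opprK => -> //.
by lra.
Qed.

End PiecewiseAffine.

(** * Integration by parts against affine pieces *)

Section IntegrationByParts.
Context {R : realType}.
Implicit Types (phi dphi : R -> R).
Local Notation mu := (@lebesgue_measure R).

Lemma continuous_derivable_oo (F f : R -> R) a b : (forall x : R, is_derive x 1 F (f x)) ->
  derivable_oo_LRcontinuous F a b.
Proof.
move=> dF; have cF : continuous F.
  by move=> x; apply: differentiable_continuous; apply/derivable1_diffP; have d := dF x; exact: ex_derive.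
by split; [move=> x _; have d := dF x; exact: ex_derive|apply: cvg_at_right_filter; exact: cF|apply: cvg_at_left_filter; exact: cF].
Qed.

Lemma Rintegral_by_parts_affine phi dphi a b q : a < b ->
  (forall x : R, is_derive x 1 phi (dphi x)) -> continuous dphi ->
  \int[mu]_(x in `[a, b]) ((x - q) * dphi x) =
  (b - q) * phi b - (a - q) * phi a - \int[mu]_(x in `[a, b]) phi x.
Proof.
move=> ab dp cdp.
have dq (x : R) : is_derive x 1 (fun x => x - q) (1 : R) by apply: is_derive_eq; rewrite subr0.
rewrite (@Rintegration_by_parts _ (fun x => x - q) phi (cst 1) dphi)//.
- by congr (_ - _); apply: eq_Rintegral => x _; rewrite mul1r.
- by apply: continuous_subspaceT => x; exact: cvg_cst.
- exact: continuous_derivable_oo dq.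
- by move=> x _; rewrite derive1E (@derive_val _ _ _ _ _ _ _ (dq x)).
- exact: continuous_subspaceT.
- exact: continuous_derivable_oo dp.
- by move=> x _; rewrite derive1E (@derive_val _ _ _ _ _ _ _ (dp x)).
Qed.

Lemma Rintegral_derive phi dphi a b : a < b ->
  (forall x : R, is_derive x 1 phi (dphi x)) -> continuous dphi ->
  \int[mu]_(x in `[a, b]) dphi x = phi b - phi a.
Proof.
move=> ab dp cdp; rewrite /Rintegral (continuous_FTC2 ab _ (continuous_derivable_oo _ _ dp)).
- by rewrite -EFinB.
- exact: continuous_subspaceT.
- by move=> x _; rewrite derive1E (@derive_val _ _ _ _ _ _ _ (dp x)).
Qed.

Lemma Rintegral_patch (A : set R) (f g : R -> R) : (forall x, A x -> f x = g x) ->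
  (forall x, ~ A x -> f x = 0) -> \int[mu]_x f x = \int[mu]_(x in A) g x.
Proof.
move=> fg f0; rewrite [RHS]Rintegral_mkcond; congr Rintegral; apply/funext => x.
by rewrite patchE; case: ifPn => [/set_mem/fg|/negP xA]; [|apply: f0 => /mem_set].
Qed.

Lemma integrable_vanishing (f : R -> R) c d : continuous f ->
  (forall x, x \notin `[c, d] -> f x = 0) -> mu.-integrable setT (EFin \o f).
Proof.
move=> cf f0.
have -> : EFin \o f = (EFin \o f) \_ `[c, d].
  apply/funext => x; rewrite patchE; case: ifPn => //= /negP xcd.
  by rewrite f0//; apply/negP => h; apply: xcd; exact/mem_set.
apply/(integrable_mkcond _ _).1 => //.
by apply: continuous_compact_integrable; [exact: segment_compact|exact: continuous_subspaceT].
Qed.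

(** Integration by parts on [[q, M]]: the factor x - q kills the boundary term at q, and phi
    vanishes at M. The half-line is open because it will represent the times at which gamma is
    strictly positive. *)
Lemma Rintegral_pos_part phi dphi c d q : (forall x : R, is_derive x 1 phi (dphi x)) ->
  continuous dphi -> (forall x, x \notin `[c, d] -> phi x = 0) ->
  (forall x, x \notin `[c, d] -> dphi x = 0) ->
  \int[mu]_x (Num.max 0 (x - q) * dphi x) = - \int[mu]_x (phi \_ `]q, +oo[) x.
Proof.
(* Adding 1 puts M strictly beyond both q and the interval that carries phi. *)
move=> dp cdp p0 dp0; pose M := Num.max q d + 1.
have qM : q < M by rewrite /M ltr_pwDr// le_max lexx.
have dM x : M <= x -> x \notin `[c, d].
  move=> Mx; rewrite in_itv /= negb_and -!ltNge; apply/orP; right.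
  by rewrite (lt_le_trans _ Mx)// ltr_pwDr// le_max lexx orbT.
have ip : mu.-integrable setT (EFin \o phi).
  apply: integrable_vanishing p0 => x; apply: differentiable_continuous.
  by apply/derivable1_diffP; have d1 := dp x; exact: ex_derive.
rewrite (@Rintegral_patch `[q, M] _ (fun x => (x - q) * dphi x)).
- rewrite Rintegral_by_parts_affine// p0 ?dM// subrr mulr0 mul0r subr0 sub0r; congr (- _).
  rewrite -Rintegral_itv_obnd_cbnd; last exact: integrableS ip.
  apply/esym; apply: Rintegral_patch => x /=.
    by rewrite in_itv/= => /andP[qx xM]; rewrite patchE mem_set//= in_itv/= qx.
  rewrite in_itv /= => /negP; rewrite negb_and patchE => h; case: ifPn => // /set_mem /=.
  by rewrite in_itv/= andbT => qx; rewrite p0// dM//; move: h; rewrite qx /= -ltNge => /ltW.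
- by move=> x /=; rewrite in_itv/= => /andP[qx _]; rewrite max_r// subr_ge0.
- move=> x /=; rewrite in_itv/= => /negP; rewrite negb_and -!ltNge => /orP[xq|Mx].
    by rewrite max_l ?mul0r// subr_le0 ltW.
  by rewrite dp0 ?mulr0// dM// ltW.
Qed.

Lemma Rintegral_neg_part phi dphi c d p : (forall x : R, is_derive x 1 phi (dphi x)) ->
  continuous dphi -> (forall x, x \notin `[c, d] -> phi x = 0) ->
  (forall x, x \notin `[c, d] -> dphi x = 0) ->
  \int[mu]_x (Num.min 0 (x - p) * dphi x) = - \int[mu]_x (phi \_ `]-oo, p[) x.
Proof.
move=> dp cdp p0 dp0; pose M := Num.min p c - 1.
have Mp : M < p by rewrite /M ltrBlDr ltr_pwDr// ge_min lexx.
have cM x : x <= M -> x \notin `[c, d].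
  move=> xM; rewrite in_itv /= negb_and -!ltNge; apply/orP; left.
  by rewrite (le_lt_trans xM)// ltrBlDr ltr_pwDr// ge_min lexx orbT.
have ip : mu.-integrable setT (EFin \o phi).
  apply: integrable_vanishing p0 => x; apply: differentiable_continuous.
  by apply/derivable1_diffP; have d1 := dp x; exact: ex_derive.
rewrite (@Rintegral_patch `[M, p] _ (fun x => (x - p) * dphi x)).
- rewrite Rintegral_by_parts_affine// [phi M]p0 ?cM// subrr mulr0 mul0r subr0 sub0r; congr (- _).
  rewrite -Rintegral_itv_bndo_bndc; last exact: integrableS ip.
  apply/esym; apply: Rintegral_patch => x /=.
    by rewrite in_itv/= => /andP[Mx xp]; rewrite patchE mem_set//= in_itv/= xp.
  rewrite in_itv /= => /negP; rewrite negb_and patchE => h; case: ifPn => // /set_mem /=.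
  by rewrite in_itv/= => xp; rewrite p0// cM//; move: h; rewrite xp orbF -ltNge => /ltW.
- by move=> x /=; rewrite in_itv/= => /andP[_ xp]; rewrite min_r// subr_le0.
- move=> x /=; rewrite in_itv/= => /negP; rewrite negb_and -!ltNge => /orP[xM|px].
    by rewrite dp0 ?mulr0// cM// ltW.
  by rewrite min_l ?mul0r// subr_ge0 ltW.
Qed.

End IntegrationByParts.

Section ContinuousParts.
Context {R : realType}.

Lemma continuous_max0 : continuous (fun z : R => Num.max 0 z).
Proof. by move=> z; apply: (@continuous_max _ _ (cst 0) id z); [exact: cvg_cst|exact: cvg_id]. Qed.

Lemma continuous_min0 : continuous (fun z : R => Num.min 0 z).
Proof. by move=> z; apply: (@continuous_min _ _ (cst 0) id z); [exact: cvg_cst|exact: cvg_id]. Qed.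

Lemma continuous_subr (q : R) : continuous (fun z : R => z - q).
Proof. by move=> z; apply: cvgB; [exact: cvg_id|exact: cvg_cst]. Qed.

Lemma continuous_pos_part (q : R) : continuous (fun z : R => Num.max 0 (z - q)).
Proof.
move=> z; apply: (@continuous_comp _ _ _ (fun z => z - q) (Num.max 0)).
  exact: continuous_subr.
exact: continuous_max0.
Qed.

Lemma continuous_neg_part (q : R) : continuous (fun z : R => Num.min 0 (z - q)).
Proof.
move=> z; apply: (@continuous_comp _ _ _ (fun z => z - q) (Num.min 0)).
  exact: continuous_subr.
exact: continuous_min0.
Qed.

End ContinuousParts.

(** * Support and regularity of test functions *)

Section TestFunctionFacts.
Context {R : realType}.
Implicit Types (D : set R) (phi : R -> R).

Lemma test_function_is_derive D phi : test_function D phi ->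
  forall x : R, is_derive x 1 phi (derive1 phi x).
Proof.
by move=> [sm _ _] x; rewrite derive1E; apply: derivableP; have [_] := sm nil; exact.
Qed.

Lemma test_function_continuous D phi : test_function D phi -> continuous phi.
Proof. by move=> [sm _ _]; have [] := sm nil. Qed.

Lemma test_function_continuous_derive D phi : test_function D phi -> continuous (derive1 phi).
Proof.
move=> [sm _ _]; have [/= cp _] := sm [:: 1]; move: cp.
by rewrite (_ : 'D_1 phi = derive1 phi)//; apply/funext => x; rewrite derive1E.
Qed.

(* When phi vanishes identically the interval [c, d] is taken empty. *)
Lemma test_function_hull D phi : is_interval D -> test_function D phi ->
  exists c d, [/\ [set` `[c, d]] `<=` D,
    forall x, x \notin `[c, d] -> phi x = 0 & forall x, x \notin `[c, d] -> derive1 phi x = 0].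
Proof.
move=> iD [_ cs sD]; set S := closure _ in cs sD.
have S0 x : ~ S x -> phi x = 0 /\ derive1 phi x = 0.
  move=> Sx; have : nbhs x (~` S) by apply: open_nbhs_nbhs; split=> //; apply: closed_openC; exact: closed_closure.
  move=> nS; have n0 : \forall y \near x, 0 = phi y.
    apply: filterS nS => y nSy; apply/esym/eqP; apply: contra_notT nSy => py.
    exact: subset_closure.
  split; first by rewrite -(nbhs_singleton n0).
  by have d0 := near_eq_is_derive n0 (is_derive_cst (0 : R) x 1); rewrite derive1E derive_val.
have [S1|/set0P/negP] := pselect (S !=set0); last first.
  rewrite negbK => /eqP SE; exists 1, 0; split.
  - by move=> x /=; rewrite in_itv/=; lra.
  - by move=> x _; apply: (S0 x _).1; rewrite SE.
  - by move=> x _; apply: (S0 x _).2; rewrite SE.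
(* The least and greatest points of the compact support bound its convex hull, which stays in D
   because D is an interval. *)
have [c cS cP] := @compact_EVT_min _ _ (id : R -> R) S S1 cs (continuous_subspaceT (fun x => cvg_id)).
have [d dS dP] := @compact_EVT_max _ _ (id : R -> R) S S1 cs (continuous_subspaceT (fun x => cvg_id)).
have Scd x : x \notin `[c, d] -> ~ S x.
  by move=> /negP xcd Sx; apply: xcd; rewrite in_itv/= cP ?dP ?mem_set.
exists c, d; split=> [x /=|x /Scd /S0[]//|x /Scd /S0[]//].
rewrite in_itv/=; apply: iD; apply: sD; exact: set_mem.
Qed.

Lemma is_interval_interior (I : interval R) : is_interval [set` I]°.
Proof.
move=> x y xI yI z; rewrite le_eqVlt => /andP[/predU1P[<-//|xz]].
rewrite le_eqVlt => /predU1P[->//|zy].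
have : \forall s \near z, s \in `]x, y[ by apply: near_in_itvoo; rewrite in_itv/= xz.
apply: filterS => s; rewrite in_itv/= => /andP[xs sy].
apply: (@interval_is_interval _ I x y); [exact: interior_subset xI|exact: interior_subset yI|].
by rewrite !ltW.
Qed.

Lemma locally_integrable_continuous D (f : R -> R) : open D -> {in D, continuous f} ->
  locally_integrable D f.
Proof.
move=> oD cf; split => //; first exact: open_continuous_measurable_fun.
move=> K KD cK; have : lebesgue_measure.-integrable K (EFin \o f).
  apply: continuous_compact_integrable => //.
  by apply: continuous_in_subspaceT => x /set_mem /KD xD; apply: cf; exact/mem_set.
by move=> /integrableP[].
Qed.

Lemma locally_integrable_eq D (f g : R -> R) : {in D, f =1 g} ->
  locally_integrable D f -> locally_integrable D g.
Proof.
move=> fg [mf oD lf]; split => //; first by apply: eq_measurable_fun mf.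
move=> K KD cK; have := lf K KD cK; congr (_ < _)%E; apply: eq_integral => x /set_mem /KD xD.
by rewrite fg//; exact/mem_set.
Qed.

End TestFunctionFacts.

(** * The derivative along an arbitrary characteristic *)

Section BroadSource.
Context {R : realType}.
Implicit Types (I : interval R) (gamma : R -> R).
Local Notation char := (characteristic (@flux R) (@u_cbrt R)).
Local Notation mu := (@lebesgue_measure R).
Local Notation src := (\1_[set p : R * R | p.2 != 0] : R * R -> R).

Lemma measurable_source : measurable_fun setT src.
Proof.
apply: measurable_indic.
have -> : [set p : R * R | p.2 != 0] = setT `&` snd @^-1` (~` [set 0]).
  by rewrite setTI; apply/seteqP; split => p /= /eqP.
by apply: measurable_snd => //; exact: measurableC.
Qed.

Lemma char_continuous_at I gamma t : char I gamma -> [set` I]° t -> {for t, continuous gamma}.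
Proof.
move=> cg tI; have d := has_derive_in_interior tI (char_deriveP cg (interior_subset tI)).
by apply: differentiable_continuous; apply/derivable1_diffP; exact: ex_derive.
Qed.

Lemma char_piecewise_affine I gamma c d : char I gamma -> [set` `[c, d]] `<=` [set` I] ->
  exists q p, forall t, t \in `[c, d] ->
    Num.max 0 (cbrt (gamma t)) = Num.max 0 (t - q) /\
    Num.min 0 (cbrt (gamma t)) = Num.min 0 (t - p).
Proof.
move=> cg cdI.
have sub a b : c <= a -> b <= d -> [set` `[a, b]] `<=` [set` I].
  by move=> ca bd; apply: subset_trans cdI; apply: subset_itv; rewrite bnd_simp.
have mono a b : c <= a -> a <= b -> b <= d -> cbrt (gamma a) <= cbrt (gamma b).
  move=> ca ab bd; rewrite ler_cbrt (char_nondecreasing cg)//; apply: (sub a b) => //=.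
    by rewrite in_itv/= lexx.
  by rewrite in_itv/= lexx ab.
have ivt a b v : c <= a -> a <= b -> b <= d ->
    cbrt (gamma a) <= v <= cbrt (gamma b) -> exists2 s, s \in `[a, b] & cbrt (gamma s) = v.
  move=> ca ab bd vP; apply: (@IVT _ (cbrt \o gamma)) => //; last first.
    by rewrite /= min_l ?max_r// mono.
  apply: within_continuous_comp; last exact: continuous_cbrt.
  exact: continuous_subspaceW (sub a b ca bd) (char_continuous cg).
have aff a b : c <= a -> a <= b -> b <= d ->
    (forall t, t \in `[a, b] -> cbrt (gamma t) != 0) -> cbrt (gamma b) - cbrt (gamma a) = b - a.
  move=> ca ab bd w0; apply: (char_cbrt_affine cg (sub a b ca bd) ab) => t /w0.
  by apply: contra_neq => ->; exact: cbrt0.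
have [q qP] := pos_part_affine mono ivt aff.
have [p pP] := neg_part_affine mono ivt aff.
by exists q, p => t; rewrite in_itv/= => tcd; rewrite qP// pP.
Qed.

Lemma char_distr_derive I gamma : char I gamma ->
  distr_derive [set` I]° (fun t => u_cbrt (t, gamma t)) (fun t => src (t, gamma t)).
Proof.
move=> cg; pose D : set R := [set` I]°; have oD : open D by exact: open_interior.
rewrite -[X in distr_derive X]/D.
have cD t : t \in D -> {for t, continuous gamma}.
  by move=> /set_mem tD; exact: char_continuous_at cg tD.
split.
- apply: locally_integrable_continuous => // t /cD ct.
  by apply: (@continuous_comp _ _ _ gamma (@cbrt R)) => //; exact: continuous_cbrt.
(* Along gamma the source is, on D, the indicator of a set that is open by continuity of gamma,
   hence measurable. *)
- pose A := D `&` gamma @^-1` (~` [set 0]).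
  have oA : open A.
    rewrite openE => t [Dt /= gt]; apply: filterI; first exact: open_nbhs_nbhs.
    have ct := cD t (mem_set Dt).
    apply: ct; apply: open_nbhs_nbhs; split => //.
    by apply: closed_openC; exact: closed_eq.
  apply: (@locally_integrable_eq _ _ \1_A).
    move=> t tD; rewrite !indicE; congr (nat_of_bool _)%:R.
    apply/idP/idP => /set_mem.
      by move=> [_ /= gt]; apply/mem_set; apply/eqP.
    by move=> /= gt; apply/mem_set; split; [exact/set_mem|exact/eqP].
  by apply: locally_integrable_indic => //; exact: open_measurable.
move=> phi tphi.
have [c [d [cdD p0 dp0]]] := test_function_hull (@is_interval_interior _ I) tphi.
have [q [p qp]] := char_piecewise_affine cg (subset_trans cdD (@interior_subset _ _)).
have ip : mu.-integrable setT (EFin \o phi).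
  exact: integrable_vanishing (test_function_continuous tphi) p0.
have dphi := test_function_is_derive tphi; have cdphi := test_function_continuous_derive tphi.
have maxmin (z : R) : z = Num.max 0 z + Num.min 0 z by rewrite maxEle minEle; case: ifP; rewrite ?add0r ?addr0.
have E1 : \int[mu]_(t in D) (u_cbrt (t, gamma t) * derive1 phi t) =
    \int[mu]_t (Num.max 0 (t - q) * derive1 phi t + Num.min 0 (t - p) * derive1 phi t).
  apply/esym/Rintegral_patch => t tD.
    have [tcd|tcd] := boolP (t \in `[c, d]); last by rewrite dp0// !mulr0 addr0.
    by rewrite -mulrDl /u_cbrt /= [in RHS](maxmin (cbrt _)) (qp t tcd).1 (qp t tcd).2.
  by rewrite dp0 ?mulr0 ?addr0//; apply/negP => /cdD.
(* On [[c, d]], gamma t > 0 exactly when t > q, and gamma t < 0 exactly when t < p. The source is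
   thus the sum of the indicators of two half-lines, the ones produced by integrating the two parts
   of w by parts. *)
have E2 : \int[mu]_(t in D) (src (t, gamma t) * phi t) =
    \int[mu]_t ((phi \_ `]q, +oo[) t + (phi \_ `]-oo, p[) t).
  apply/esym/Rintegral_patch => t tD.
    have [tcd|tcd] := boolP (t \in `[c, d]); last first.
      by rewrite !patchE p0// mulr0; case: ifP; case: ifP; rewrite addr0.
    have [qt pt] := qp t tcd; rewrite !patchE indicE !mem_setE /= !in_itv/= andbT.
    have : (0 < Num.max 0 (cbrt (gamma t))) = (0 < Num.max 0 (t - q)) by rewrite qt.
    rewrite !lt_max ltxx /= cbrt_gt0 subr_gt0 => <-.
    have : (Num.min 0 (cbrt (gamma t)) < 0) = (Num.min 0 (t - p) < 0) by rewrite pt.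
    rewrite !gt_min ltxx /= cbrt_lt0 subr_lt0 => <-.
    by rewrite unfold_in /=; case: ltgtP => _; rewrite ?mul1r ?mul0r ?addr0 ?add0r.
  by rewrite !patchE p0//; [case: ifP; case: ifP; rewrite addr0|apply/negP => /cdD].
have ipos : mu.-integrable setT (EFin \o (fun t => Num.max 0 (t - q) * derive1 phi t)).
  apply: (integrable_vanishing (c := c) (d := d)) => [t|t /dp0 ->]; last by rewrite mulr0.
  apply: cvgM; last exact: cdphi.
  exact: continuous_pos_part.
have ineg : mu.-integrable setT (EFin \o (fun t => Num.min 0 (t - p) * derive1 phi t)).
  apply: (integrable_vanishing (c := c) (d := d)) => [t|t /dp0 ->]; last by rewrite mulr0.
  apply: cvgM; last exact: cdphi.
  exact: continuous_neg_part.
have ipatch (J : interval R) : mu.-integrable setT (EFin \o (phi \_ [set` J])).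
  rewrite -restrict_EFin; apply/(integrable_mkcond _ _).1 => //; exact: integrableS ip.
rewrite E1 E2 !RintegralD// (Rintegral_pos_part q dphi cdphi p0 dp0).
by rewrite (Rintegral_neg_part p dphi cdphi p0 dp0) opprD !opprK.
Qed.

End BroadSource.

(** * The Eulerian source *)

Section PlaneMeasurability.
Context {R : realType}.
Local Notation mu := (@lebesgue_measure R).
Local Notation mu2 := (mu \x mu)%E.
Implicit Types (U K : set (R * R)) (f : R * R -> R).

(** An open set of the plane is the countable union of the rational open boxes that it contains, and
    boxes belong to the product sigma-algebra. *)
Lemma open_measurable2 U : open U -> measurable U.
Proof.
move=> oU.
pose box (q : rat * rat * (rat * rat)) : set (R * R) :=
  `]ratr q.1.1, ratr q.1.2[ `*` `]ratr q.2.1, ratr q.2.2[.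
pose B n := if unpickle n is Some q then
  if `[< box q `<=` U >] then box q else set0 else set0.
have BE q : box q `<=` U -> B (pickle q) = box q by move=> qU; rewrite /B pickleK asboolT.
have -> : U = \bigcup_n B n.
  apply/seteqP; split => [p Up|p [n _]]; last first.
    by rewrite /B; case: (unpickle n) => // q; case: ifPn => // /asboolP; exact.
  have : nbhs p U by exact: open_nbhs_nbhs.
  move=> /nbhs_ballP[e /= e0 eU].
  have rl (x : R) : x - e < x by rewrite ltrBlDr ltrDl.
  have rr (x : R) : x < x + e by rewrite ltrDl.
  have [a] := rat_in_itvoo (rl p.1); rewrite in_itv /= => /andP[a1 a2].
  have [b] := rat_in_itvoo (rr p.1); rewrite in_itv /= => /andP[b1 b2].
  have [c] := rat_in_itvoo (rl p.2); rewrite in_itv /= => /andP[c1 c2].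
  have [d] := rat_in_itvoo (rr p.2); rewrite in_itv /= => /andP[d1 d2].
  exists (pickle ((a, b), (c, d))); first exact: I.
  rewrite BE; first by split => /=; rewrite in_itv/= ?a2 ?b1 ?c2 ?d1.
  move=> [x y] [/=]; rewrite !in_itv/= => /andP[ax xb] /andP[cy yd]; apply: eU.
  by split; rewrite /ball/= ltr_distlC; lra.
apply: bigcupT_measurable => n; rewrite /B; case: (unpickle n) => // q.
by case: ifPn => // _; apply: measurableX.
Qed.

Lemma continuous_measurable_fun2 f : continuous f -> measurable_fun setT f.
Proof.
move=> cf; apply: (measurability _ (RGenOpens.measurableE R)).
move=> _ [_ [a [b ->] <-]]; apply: open_measurable2; rewrite setTI.
by apply: open_comp; [move=> + _; exact: cf|exact: interval_open].
Qed.

Lemma compact_measurable2 K : compact K -> measurable K.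
Proof.
move=> cK; rewrite -(setCK K); apply: measurableC; apply: open_measurable2.
by apply: closed_openC; apply: compact_closed => //; exact: norm_hausdorff.
Qed.

Lemma compact_box K : compact K -> exists M : R, 0 < M /\
  K `<=` `[- M, M] `*` `[- M, M].
Proof.
move=> /compact_bounded[M [Mr KM]]; pose N := Num.max M 0 + 1.
have MN : M < N by rewrite /N ltr_pwDr// le_max lexx.
have N0 : 0 < N by rewrite /N ltr_pwDr// le_max lexx orbT.
exists N; split => // -[x y] /(KM N MN) /=; rewrite prod_normE /= ge_max => /andP[xN yN].
by split; rewrite /= in_itv/= -ler_norml.
Qed.

Lemma compact_mu2_fin K : compact K -> (mu2 K < +oo)%E.
Proof.
move=> cK; have [M [M0 KM]] := compact_box cK.
pose B : set (R * R) := `[- M, M] `*` `[- M, M].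
apply: (@le_lt_trans _ _ (mu2 B)).
  apply: le_measure => //; rewrite ?inE; first exact: compact_measurable2.
  exact: measurableX.
rewrite product_measure1E//= lebesgue_measure_itv/=; case: ifP => _; last by rewrite mule0.
by rewrite -EFinB -EFinM ltry.
Qed.

Lemma continuous_integrable2 f K : continuous f -> compact K -> mu2.-integrable K (EFin \o f).
Proof.
move=> cf cK; have mK := compact_measurable2 cK.
have [M [_ fM]] := compact_bounded (continuous_compact (continuous_subspaceT cf) cK).
have mf : measurable_fun K f by apply: measurable_funTS; exact: continuous_measurable_fun2.
apply: (@le_integrable _ _ _ _ _ _ _ (cst (M + 1)%:E)) => //.
- exact/measurable_EFinP.
- move=> p Kp /=; rewrite lee_fin; apply: le_trans (ler_norm _).
  by apply: (fM (M + 1)); [rewrite ltrDl|exists p].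
- apply/integrableP; split; first exact: measurable_cst.
  under eq_integral do rewrite abse_EFin /=.
  by rewrite integral_cst// lte_mul_pinfty//; exact: compact_mu2_fin.
Qed.

Lemma continuous_locally_integrable2 f : continuous f -> locally_integrable2 f.
Proof.
move=> cf; split; first exact: continuous_measurable_fun2.
by move=> K cK; have /integrableP[] := continuous_integrable2 cf cK.
Qed.

Lemma integrable2_vanishing f K : continuous f -> compact K ->
  (forall p, ~ K p -> f p = 0) -> mu2.-integrable setT (EFin \o f).
Proof.
move=> cf cK f0; have mK := compact_measurable2 cK.
have -> : EFin \o f = (EFin \o f) \_ K.
  apply/funext => p; rewrite patchE; case: ifPn => //= /negP pK.
  by rewrite f0// => Kp; apply: pK; exact/mem_set.
by apply/(integrable_mkcond _ _).1 => //; exact: continuous_integrable2.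
Qed.

End PlaneMeasurability.

(** * Testing the conservation law by Fubini's theorem *)

Section EulerianSource.
Context {R : realType}.
Local Notation mu := (@lebesgue_measure R).
Local Notation mu2 := (mu \x mu)%E.
Implicit Types (phi F : R * R -> R).

Lemma Rintegral_derive_vanishing (F dF : R -> R) M : (forall x : R, is_derive x 1 F (dF x)) ->
  continuous dF -> 0 < M -> (forall x, M < `|x| -> F x = 0) -> (forall x, M < `|x| -> dF x = 0) ->
  \int[mu]_x dF x = 0.
Proof.
move=> dFP cdF M0 F0 dF0.
(* F is known to vanish only where |x| > M strictly, so the endpoints are moved one unit beyond
   M. *)
rewrite (@Rintegral_patch _ `[- (M + 1), M + 1] _ dF) => //=.
- rewrite (Rintegral_derive _ dFP)//; last by lra.
  by rewrite !F0 ?subrr// ?normrN gtr0_norm; lra.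
- by move=> x /negP; rewrite in_itv/= -ler_norml -ltNge => xM; apply: dF0; lra.
Qed.

Lemma derivable_section1 phi t x : derivable phi (t, x) (1, 0) ->
  is_derive t 1 (fun s => phi (s, x)) ('D_(1, 0) phi (t, x)).
Proof.
have E (h : R) : h^-1 *: (phi (h *: 1 + t, x) - phi (t, x)) =
    h^-1 *: (phi (h *: (1, 0) + (t, x)) - phi (t, x)).
  have -> // : h *: ((1, 0) : R * R) + (t, x) = (h *: 1 + t, x).
  by rewrite -[LHS]/(h *: 1 + t, h *: 0 + x) scaler0 add0r.
move=> d; apply: DeriveDef; rewrite /derivable /derive /=.
  by under eq_fun do rewrite E; exact: d.
by under eq_fun do rewrite E.
Qed.

Lemma derivable_section2 phi t x : derivable phi (t, x) (0, 1) ->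
  is_derive x 1 (fun z => phi (t, z)) ('D_(0, 1) phi (t, x)).
Proof.
have E (h : R) : h^-1 *: (phi (t, h *: 1 + x) - phi (t, x)) =
    h^-1 *: (phi (h *: (0, 1) + (t, x)) - phi (t, x)).
  have -> // : h *: ((0, 1) : R * R) + (t, x) = (t, h *: 1 + x).
  by rewrite -[LHS]/(h *: 0 + t, h *: 1 + x) scaler0 add0r.
move=> d; apply: DeriveDef; rewrite /derivable /derive /=.
  by under eq_fun do rewrite E; exact: d.
by under eq_fun do rewrite E.
Qed.

Lemma Rintegral_fubini21 F : mu2.-integrable setT (EFin \o F) ->
  (forall x, \int[mu]_t F (t, x) = 0) ->
  (forall x, mu.-integrable setT (EFin \o (fun t => F (t, x)))) ->
  \int[mu2]_p F p = 0.
Proof.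
move=> iF F0 iFx; rewrite /Rintegral -(integral21_prod_meas1 iF) /fubini_G.
rewrite (_ : (fun y => _) = cst 0%E) ?integral0//; apply/funext => x /=.
(* A real integral is the [fine] part of an extended one, and [fine] sends infinities to 0;
   integrability of the section makes its value 0 genuine. *)
rewrite -[LHS]fineK; last exact: integrable_fin_num (iFx x).
by rewrite -[0%E]/(0%:E) -(F0 x).
Qed.

Lemma Rintegral_fubini12 F : mu2.-integrable setT (EFin \o F) ->
  (forall t, \int[mu]_x F (t, x) = 0) ->
  (forall t, mu.-integrable setT (EFin \o (fun x => F (t, x)))) ->
  \int[mu2]_p F p = 0.
Proof.
move=> iF F0 iFx; rewrite /Rintegral -(integral12_prod_meas1 iF) /fubini_F.
rewrite (_ : (fun y => _) = cst 0%E) ?integral0//; apply/funext => t /=.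
rewrite -[LHS]fineK; last exact: integrable_fin_num (iFx t).
by rewrite -[0%E]/(0%:E) -(F0 t).
Qed.

Lemma eulerian_source_1 : eulerian_source (@flux R) u_cbrt (cst 1).
Proof.
have cu : continuous (@u_cbrt R).
  move=> p; apply: (@continuous_comp _ _ _ snd (@cbrt R)); last exact: continuous_cbrt.
  exact: cvg_snd.
have fu : (@flux R) \o u_cbrt = snd by apply/funext => p /=; exact: cbrt_cube.
have csnd : continuous (@snd R R) by move=> p; exact: cvg_snd.
split; first exact: continuous_locally_integrable2.
- by rewrite fu; exact: continuous_locally_integrable2.
- by apply: continuous_locally_integrable2 => p; exact: cvg_cst.
move=> phi [sm cS _]; set S := closure _ in cS.
have S0 p : ~ S p -> [/\ phi p = 0, 'D_(1, 0) phi p = 0 & 'D_(0, 1) phi p = 0].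
  move=> Sp; have nS : nbhs p (~` S).
    by apply: open_nbhs_nbhs; split=> //; apply: closed_openC; exact: closed_closure.
  have n0 : \forall q \near p, 0 = phi q.
    apply: filterS nS => q nSq; apply/esym/eqP; apply: contra_notT nSq => pq.
    exact: subset_closure.
  split; first by rewrite -(nbhs_singleton n0).
    by have d0 := near_eq_is_derive n0 (is_derive_cst (0 : R) p (1, 0)); rewrite derive_val.
  by have d0 := near_eq_is_derive n0 (is_derive_cst (0 : R) p (0, 1)); rewrite derive_val.
have [M [M0 SM]] := compact_box cS.
have out1 t x : M < `|t| -> ~ S (t, x).
  by move=> Mt /SM[/=]; rewrite in_itv/= -ler_norml leNgt Mt.
have out2 t x : M < `|x| -> ~ S (t, x).
  by move=> Mx /SM[/=] _; rewrite in_itv/= -ler_norml leNgt Mx.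
have cphi : continuous phi by have [] := sm nil.
have c10 : continuous ('D_(1, 0) phi) by have [] := sm [:: (1, 0)].
have c01 : continuous ('D_(0, 1) phi) by have [] := sm [:: (0, 1)].
have cs1 (F : R * R -> R) x : continuous F -> continuous (fun t => F (t, x)).
  move=> cF t; apply: (@continuous_comp _ _ _ (fun t => (t, x)) F); last exact: cF.
  by apply: (@cvg_pair _ _ _ _ (nbhs (t : R)) (nbhs (x : R))); [exact: cvg_id|exact: cvg_cst].
have cs2 (F : R * R -> R) t : continuous F -> continuous (fun x => F (t, x)).
  move=> cF x; apply: (@continuous_comp _ _ _ (fun x => (t, x)) F); last exact: cF.
  by apply: (@cvg_pair _ _ _ _ (nbhs (t : R)) (nbhs (x : R))); [exact: cvg_cst|exact: cvg_id].
have itv_out x : x \notin `[- M, M] -> M < `|x|.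
  by rewrite in_itv/= -ler_norml -ltNge.
(* For fixed x the factor cbrt x is constant in t, so the integrand is the t-derivative of the
   compactly supported function cbrt x * phi. *)
have I1 : \int[mu2]_p (u_cbrt p * 'D_(1, 0) phi p) = 0.
  have cF : continuous (fun p => u_cbrt p * 'D_(1, 0) phi p).
    by move=> p; apply: cvgM; [exact: cu|exact: c10].
  apply: Rintegral_fubini21.
  - by apply: (integrable2_vanishing cF cS) => p /S0[_ -> _]; rewrite mulr0.
  - move=> x; apply: (@Rintegral_derive_vanishing (fun t => cbrt x * phi (t, x)) _ M _ _ M0).
    + by move=> t; apply: is_derive_mull; apply: derivable_section1; have [_] := sm nil; exact.
    + exact: cs1 cF.
    + by move=> t /(out1 t x)/S0[-> _ _]; rewrite mulr0.
    + by move=> t /(out1 t x)/S0[_ -> _]; rewrite mulr0.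
  - move=> x; apply: (integrable_vanishing (cs1 _ x cF)) => t /itv_out /(out1 t x)/S0[_ -> _].
    by rewrite mulr0.
have cF2 : continuous (fun p : R * R => p.2 * 'D_(0, 1) phi p).
  by move=> p; apply: cvgM; [exact: csnd|exact: c01].
have iF2 : mu2.-integrable setT (EFin \o (fun p : R * R => p.2 * 'D_(0, 1) phi p)).
  by apply: (integrable2_vanishing cF2 cS) => p /S0[_ _ ->]; rewrite mulr0.
have iphi : mu2.-integrable setT (EFin \o phi).
  by apply: (integrable2_vanishing cphi cS) => p /S0[].
(* For fixed t the integrand is the x-derivative of x * phi, where x is the flux along the solution;
   the term phi is the contribution of the source 1. *)
have I2 : \int[mu2]_p (p.2 * 'D_(0, 1) phi p + phi p) = 0.
  have cF : continuous (fun p : R * R => p.2 * 'D_(0, 1) phi p + phi p).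
    by move=> p; apply: cvgD; [exact: cF2|exact: cphi].
  apply: Rintegral_fubini12.
  - by apply: (integrable2_vanishing cF cS) => p /S0[-> _ ->]; rewrite mulr0 addr0.
  - move=> t; apply: (@Rintegral_derive_vanishing (fun x => x * phi (t, x)) _ M _ _ M0).
    + move=> x; have d : is_derive x 1 (fun z => phi (t, z)) ('D_(0, 1) phi (t, x)).
        by apply: derivable_section2; have [_] := sm nil; exact.
      by apply: (is_derive_eq (is_derive_mulr (is_derive_id x 1) d)); rewrite /= mulr1.
    + exact: cs2 cF.
    + by move=> x /(out2 t x)/S0[-> _ _]; rewrite mulr0.
    + by move=> x /(out2 t x)/S0[-> _ ->]; rewrite mulr0 addr0.
  - move=> t; apply: (integrable_vanishing (cs2 _ t cF)) => x /itv_out /(out2 t x)/S0[-> _ ->].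
    by rewrite mulr0 addr0.
rewrite RintegralD// in I2.
have -> : (fun p => flux (u_cbrt p) * 'D_(0, 1) phi p) = (fun p => p.2 * 'D_(0, 1) phi p).
  by apply/funext => p; rewrite -[flux (u_cbrt p)]/((@flux R \o u_cbrt) p) fu.
have -> : (fun p => cst 1 p * phi p) = phi by apply/funext => p; rewrite mul1r.
by move/eqP: I2; rewrite addr_eq0 => /eqP I2; rewrite [X in - X - _ = _]I1 oppr0 sub0r [X in - X = _]I2 opprK.
Qed.

End EulerianSource.

(** * The Lagrangian parameterization *)

Section LagrangianParameterization.
Context {R : realType}.
Implicit Types (t x y a : R).
Local Notation char := (characteristic (@flux R) (@u_cbrt R)).

(** Along w^3 the solution equals w, so the equation reads (w^3)' = 3 w^2. The derivative is assumed
    for the cube, since w will also be a positive or negative part, which has a corner. *)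
Lemma characteristic_cube (I : interval R) (w : R -> R) : continuous w ->
  (forall t : R, is_derive t 1 (fun s => w s ^+ 3) (3 * w t ^+ 2)) ->
  char I (fun t => w t ^+ 3).
Proof.
move=> cw dw; exists (fun t => 3 * w t ^+ 2); split.
- apply: continuous_subspaceT => t.
  apply: (@continuous_comp _ _ _ w (fun z => 3 * z ^+ 2)); first exact: cw.
  by apply: cvgM; [exact: cvg_cst|exact: exprn_continuous].
- by move=> t _; exact: is_derive_has_derive_in.
- by move=> t _; rewrite derive1_flux /u_cbrt /= cube_cbrt.
Qed.

Lemma characteristic_0 (I : interval R) : char I (cst 0).
Proof.
have -> : cst 0 = (fun t => (cst 0 : R -> R) t ^+ 3) by apply/funext => t; rewrite expr0n.
apply: characteristic_cube => t; first exact: cvg_cst.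
by rewrite [X in is_derive _ _ _ X](_ : _ = 0); [exact: (is_derive_cst (0 ^+ 3 : R))|rewrite /= expr0n mulr0].
Qed.

Lemma is_derive_subr (q t : R) : is_derive t 1 (fun s => s - q) (1 : R).
Proof. by apply: is_derive_eq; rewrite subr0. Qed.

Lemma is_derive_cube_subr q t : is_derive t 1 (fun s => (s - q) ^+ 3) (3 * (t - q) ^+ 2).
Proof.
apply: (is_derive_eq (@is_derive1_comp _ (fun z => z ^+ 3) (fun s => s - q) _ _ _ (is_derive_exprn 3 (t - q)) (is_derive_subr q t))).
by rewrite mulr1.
Qed.

Lemma is_derive_cube_pos_part q t :
  is_derive t 1 (fun s => Num.max 0 (s - q) ^+ 3) (3 * Num.max 0 (t - q) ^+ 2).
Proof.
have [tq|qt] := leP t q.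
  rewrite [in X in is_derive _ _ _ X]max_l ?subr_le0// expr0n mulr0.
  (* For t <= q < s one has 0 < s - q <= s - t, so two of the three factors are absorbed by (s -
     t)^2. *)
  apply: (@is_derive_sqr_bound _ _ (fun s => Num.max 0 (s - q))).
  - by rewrite max_l ?subr_le0// expr0n.
  - move=> s; have m0 : 0 <= Num.max 0 (s - q) by rewrite le_max lexx.
    rewrite ger0_norm ?exprn_ge0// exprSr ler_wpM2r//.
    have [sq|qs] := leP s q; first by rewrite max_l ?subr_le0// expr0n sqr_ge0.
    rewrite max_r; last by rewrite subr_ge0 ltW.
    rewrite ler_sqr ?nnegrE; lra.
  - exact: continuous_pos_part.
have nq : \forall s \near t, (s - q) ^+ 3 = Num.max 0 (s - q) ^+ 3.
  have : \forall s \near t, q < s by exact: lt_nbhsr.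
  by apply: filterS => s qs; rewrite max_r// subr_ge0 ltW.
rewrite [in X in is_derive _ _ _ X]max_r ?subr_ge0 ?ltW//.
exact: near_eq_is_derive nq (is_derive_cube_subr q t).
Qed.

Lemma is_derive_cube_neg_part q t :
  is_derive t 1 (fun s => Num.min 0 (s - q) ^+ 3) (3 * Num.min 0 (t - q) ^+ 2).
Proof.
have minE (z : R) : Num.min 0 (z - q) = - Num.max 0 (- z - - q).
  by rewrite -opprD oppr_max oppr0 opprK.
have -> : (fun s => Num.min 0 (s - q) ^+ 3) =
    (fun s => -1 * ((fun s => Num.max 0 (s - - q) ^+ 3) \o -%R) s).
  by apply/funext => s /=; rewrite minE; ring.
have dN : is_derive t 1 (-%R : R -> R) (-1) by apply: is_derive_eq.
apply: (is_derive_eq (is_derive_mull (-1) (is_derive1_comp (is_derive_cube_pos_part (- q) (- t)) dN))).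
by rewrite minE; ring.
Qed.

Lemma chi_posE t y : chi_pos t y = Num.max 0 (t - - artanh (y - 1)) ^+ 3.
Proof.
rewrite /chi_pos opprK; case: leP => h; first by rewrite max_r//; lra.
by rewrite max_l ?expr0n//; lra.
Qed.

(** This symmetry transfers results from y > 0 to y < 0. *)
Lemma chi_opp t y : chi (- t, - y) = - chi (t, y) :> R.
Proof.
by rewrite /chi /= oppr_gt0 oppr_lt0 !opprK; case: ltgtP => _; rewrite ?opprK ?oppr0.
Qed.

Lemma chi_gt0E t y : 0 < y -> chi (t, y) = Num.max 0 (t - - artanh (y - 1)) ^+ 3.
Proof. by move=> y0; rewrite /chi /= y0 chi_posE. Qed.

Lemma chi_lt0E t y : y < 0 -> chi (t, y) = Num.min 0 (t - artanh (- y - 1)) ^+ 3.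
Proof.
move=> y0; rewrite -[chi _]opprK -chi_opp chi_gt0E ?oppr_gt0//.
by rewrite -[in RHS](opprK (t - _)) -[in RHS](oppr0 R) -oppr_max opprB opprK addrC; ring.
Qed.

Lemma chi0E t : chi (t, 0) = 0 :> R.
Proof. by rewrite /chi /= ltxx. Qed.

Lemma chi_ge0 t y : 0 <= y -> 0 <= chi (t, y).
Proof.
rewrite le_eqVlt => /predU1P[<-|y0]; first by rewrite chi0E.
by rewrite chi_gt0E// exprn_ge0// le_max lexx.
Qed.

Lemma chi_le0 t y : y <= 0 -> chi (t, y) <= 0.
Proof. by move=> y0; rewrite -oppr_ge0 -chi_opp chi_ge0// oppr_ge0. Qed.

Lemma tanhN x : tanh (- x) = - tanh x :> R.
Proof. by rewrite /tanh opprK -mulNr opprB (addrC (expR (- x)) (expR x)). Qed.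

(** In the parameter t0 = - artanh (y - 1), the curve stays at 0 until time t0 and then follows (t -
    t0)^3. *)
Lemma chi_tanh t t0 : chi (t, 1 - tanh t0) = Num.max 0 (t - t0) ^+ 3 :> R.
Proof.
have /andP[_ t1] := tanh_itv t0; rewrite chi_gt0E ?subr_gt0//.
by rewrite addrAC subrr sub0r -tanhN tanhK opprK.
Qed.

Lemma chi_characteristic y : char `]-oo, +oo[ (fun t => chi (t, y)).
Proof.
have [y0|y0|<-] := ltgtP 0 y.
- under eq_fun do rewrite chi_gt0E//.
  apply: (@characteristic_cube _ (fun t => Num.max 0 (t - - artanh (y - 1)))) => t.
    exact: continuous_pos_part.
  exact: is_derive_cube_pos_part.
- under eq_fun do rewrite chi_lt0E//.
  apply: (@characteristic_cube _ (fun t => Num.min 0 (t - artanh (- y - 1)))) => t.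
    exact: continuous_neg_part.
  exact: is_derive_cube_neg_part.
- by under eq_fun do rewrite chi0E; exact: characteristic_0.
Qed.

(** For y > 0 the departure time - artanh (y - 1) decreases as y grows, so curves with larger y
    leave 0 earlier. Negative y follow by symmetry, and curves on opposite sides are ordered by
    their signs. *)
Lemma chi_nondecreasing t y z : -2 < y -> z < 2 -> y <= z -> chi (t, y) <= chi (t, z).
Proof.
have pos (s a b : R) : 0 < a -> b < 2 -> a <= b -> chi (s, a) <= chi (s, b).
  move=> a0 b2 ab; rewrite !chi_gt0E//; last exact: lt_le_trans ab.
  rewrite ler_cube ge_max !le_max lexx /=; apply/orP; right.
  by rewrite !opprK lerD2l ler_artanh; lra.
move=> y2 z2 yz; have [y0|y0] := ltP 0 y; first exact: pos.
have [z0|z0] := ltP z 0; last by rewrite (le_trans (chi_le0 _ _))// chi_ge0.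
by rewrite -lerN2 -!chi_opp pos; lra.
Qed.

Lemma chi_surj t x : exists2 y : R, -2 < y < 2 & chi (t, y) = x.
Proof.
have pos (s z : R) : 0 < z -> exists2 y : R, -2 < y < 2 & chi (s, y) = z.
  (* The curve that reaches z > 0 at time s must have left 0 at time s - cbrt z. *)
  move=> z0; exists (1 - tanh (s - cbrt z)).
    by have := tanh_itv (s - cbrt z); lra.
  by rewrite chi_tanh opprB addrC subrK max_r ?cbrt_cube// ltW// cbrt_gt0.
have [x0|x0|<-] := ltgtP 0 x; first exact: pos.
  have [|y y2 cy] := pos (- t) (- x); first by rewrite oppr_gt0.
  by exists (- y); [lra|rewrite -[t]opprK chi_opp cy opprK].
by exists 0; [lra|exact: chi0E].
Qed.

Lemma chi_continuous t y : -2 < y < 2 -> {for (t, y), continuous (@chi R)}.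
Proof.
have c3 : continuous (fun r : R => Num.max 0 r ^+ 3).
  move=> r; apply: (@continuous_comp _ _ _ (fun r : R => Num.max 0 r) (fun r : R => r ^+ 3)).
    exact: continuous_max0.
  exact: exprn_continuous.
have pos (s z : R) : 0 < z -> z < 2 -> {for (s, z), continuous (@chi R)}.
  move=> z0 z2; rewrite /prop_for /continuous_at chi_gt0E//.
  have n0 : \forall p \near (s, z), Num.max 0 (p.1 - - artanh (p.2 - 1)) ^+ 3 = chi p.
    have csnd : {for (s, z), continuous (@snd R R)} by exact: cvg_snd.
    by move/(cvgr_gt _ csnd): z0; apply: filterS => -[s' z'] /= z'0; rewrite chi_gt0E.
  apply: cvg_trans; first exact: near_eq_cvg n0.
  apply: (@cvg_comp _ _ _ (fun p : R * R => p.1 - - artanh (p.2 - 1)) (fun r => Num.max 0 r ^+ 3) _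
    (nbhs (s - - artanh (z - 1)))); last first.
    exact: c3.
  apply: cvgB; first exact: cvg_fst.
  apply: cvgN; apply: (@cvg_comp _ _ _ (fun p : R * R => p.2 - 1) (@artanh R) _ (nbhs (z - 1))).
    by apply: cvgB; [exact: cvg_snd|exact: cvg_cst].
  by apply: continuous_artanh; lra.
move=> /andP[y1 y2]; have [y0|y0|y0] := ltgtP 0 y; first exact: pos.
  have -> : @chi R = (fun p => - chi (- p)).
    by apply/funext => -[s z]; rewrite -[RHS]/(- chi (- s, - z)) chi_opp opprK.
  apply: cvgN; apply: (@continuous_comp _ _ _ (-%R : R * R -> R * R) (@chi R)).
    exact: opp_continuous.
  by apply: pos; rewrite /=; lra.
rewrite -y0 /prop_for /continuous_at chi0E.
have n0 : \forall p \near (t, 0 : R), 0 = chi p.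
  (* For 0 < z < 1 - tanh T the departure time exceeds T, so [chi (s, z)] is 0 whenever |s| < T.
     With its reflection, this makes [chi] vanish on a whole neighbourhood of (t, 0). *)
  pose T : R := `|t| + 1; have /andP[_ T1] := tanh_itv T.
  have d0 : 0 < Num.min 1 (1 - tanh T) by rewrite lt_min ltr01 subr_gt0.
  have Z (s z : R) : `|s| < T -> 0 < z -> z < 1 - tanh T -> chi (s, z) = 0.
    move=> sT z0 zT; rewrite chi_gt0E// max_l ?expr0n//.
    have : artanh (z - 1) <= artanh (tanh (- T)).
      by have tT := tanh_itv T; apply: ler_artanh; rewrite ?tanhN; lra.
    by rewrite tanhK; move: sT; rewrite ltr_norml; lra.
  apply/nbhs_ballP; exists (Num.min 1 (1 - tanh T)) => //= -[s z] [].
  rewrite /ball /= lt_min => /andP[ts _]; rewrite sub0r normrN lt_min => /andP[_ zT].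
  have sT : `|s| < T.
    rewrite -[s](subKr t) (le_lt_trans (ler_normB _ _))// ltrD2l//.
  have [z0|z0|<-] := ltgtP 0 z; last by rewrite chi0E.
    by rewrite Z//; move: zT; rewrite gtr0_norm.
  apply/esym/oppr_inj; rewrite -chi_opp oppr0 Z ?normrN ?oppr_gt0//.
  by move: zT; rewrite ltr0_norm.
by apply: cvg_trans; [exact: near_eq_cvg n0|exact: cvg_cst].
Qed.

Lemma chi_lagrangian : lagrangian_parameterization (@flux R) u_cbrt `]-2, 2[ (@chi R).
Proof.
split; first exact: interval_open.
split.
- apply/subspace_continuousP => -[t y] [_ /=]; rewrite in_itv/= => y2.
  by apply: cvg_within_filter; exact: chi_continuous.
- by move=> y _; exact: chi_characteristic.
- move=> t y z; rewrite !in_itv/= => /andP[y2 _] /andP[_ z2] yz; exact: chi_nondecreasing.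
- move=> [t x] _; have [y y2 cy] := chi_surj t x.
  by exists (t, y); [split => //=; rewrite in_itv|rewrite /= cy].
Qed.

End LagrangianParameterization.

(** * Uniqueness of the Broad source and failure of the source 1 *)

Section SourceUniqueness.
Context {R : realType}.
Implicit Types (I : interval R) (P : R -> Prop) (g : R * R -> R).
Local Notation mu := (@lebesgue_measure R).
Local Notation char := (characteristic (@flux R) (@u_cbrt R)).
Local Notation src := (\1_[set p : R * R | p.2 != 0] : R * R -> R).

(** The excluded points are the endpoints of I; a missing endpoint is replaced by the other one, and
    by 0 if both are missing. *)
Lemma itv_interior_endpoints I : exists x y, forall t, t \in I -> t != x -> t != y -> [set` I]° t.
Proof.
case: I => -[bl x|bl] [br y|br].
- exists x, y => t; rewrite itv_boundlr interior_itv /= in_itv/= => /andP[xt ty] tx ty'.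
  rewrite !lt_neqAle ty' [x == t]eq_sym tx /=; apply/andP; split.
    by move: xt; case: bl; rewrite bnd_simp// => /ltW.
  by move: ty; case: br; rewrite bnd_simp// => /ltW.
- exists x, x => t; rewrite itv_boundlr; case: br => /andP[xt]//= _ tx _.
  rewrite interior_itv /= in_itv/= andbT lt_neqAle [x == t]eq_sym tx /=.
  by move: xt; case: bl; rewrite bnd_simp// => /ltW.
- exists y, y => t; rewrite itv_boundlr; case: bl => /andP[]//= _ ty ty' _.
  rewrite interior_itv /= in_itv/= lt_neqAle ty' /=.
  by move: ty; case: br; rewrite bnd_simp// => /ltW.
- exists 0, 0 => t; rewrite itv_boundlr; case: bl; case: br => /andP[]//= _ _ _ _.
  by rewrite interior_itv /= in_itv.
Qed.

Lemma ae_neq (x : R) : {ae mu, forall t : R, t != x}.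
Proof.
exists [set x]; split => //; first exact: lebesgue_measure_set1.
by move=> t /= /negP; rewrite negbK => /eqP.
Qed.

Lemma ae_interior_itv I P : {ae mu, forall t, [set` I]° t -> P t} ->
  {ae mu, forall t, t \in I -> P t}.
Proof.
have AF := ae_filter_ringOfSetsType mu.
have [x [y xyI]] := itv_interior_endpoints I.
have nx := ae_neq x; have ny := ae_neq y; move=> Pt.
apply: filterS (filterI (filterI nx ny) Pt) => t [[tx ty] tP] tI.
by apply: tP; exact: xyI.
Qed.

Lemma broad_source_unique g I gamma : broad_source (@flux R) u_cbrt g -> char I gamma ->
  {ae mu, forall t, t \in I -> g (t, gamma t) = src (t, gamma t)}.
Proof.
move=> [_ bg] cg; apply: ae_interior_itv.
exact: distr_derive_unique (bg I gamma cg) (char_distr_derive cg).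
Qed.

Lemma broad_source_char : broad_source (@flux R) u_cbrt src.
Proof. by split; [exact: measurable_source|exact: char_distr_derive]. Qed.

(* Along the curve x = 0 the solution is constant, so its only source vanishes. *)
Lemma not_distr_derive_0 : ~ distr_derive setT (fun t : R => u_cbrt (t, 0)) (cst 1).
Proof.
have := @char_distr_derive R `]-oo, +oo[ (cst 0) (characteristic_0 _).
rewrite interior_itv set_itvNyy => d0 d1.
have [N [mN N0 sN]] := distr_derive_unique d0 d1.
(* If both 0 and 1 were derivatives, they would differ only on the null set N, which would then
   contain the whole line. *)
have : (mu [set: R] <= mu N)%E.
  apply: le_measure; rewrite ?inE// => t _; apply: sN => /(_ I) /=.
  by rewrite indicE /= memNset /=; [move/eqP; rewrite eq_sym oner_eq0|rewrite /= eqxx].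
by rewrite N0 -set_itvNyy lebesgue_measure_itv.
Qed.

End SourceUniqueness.

Theorem mainTheorem6 (R : realType) :
  (forall z : R, is_derive z 1 (@flux R) (3 * z ^+ 2)) /\
  (forall p : R * R, flux (u_cbrt p) = p.2) /\
  (forall t x : R, is_derive t 1 (fun s => u_cbrt (s, x)) 0 /\
     is_derive x 1 (fun z => flux (u_cbrt (t, z))) 1) /\
  eulerian_source (@flux R) u_cbrt (cst 1) /\
  characteristic (@flux R) u_cbrt `]-oo, +oo[ (cst 0) /\
  (forall t : R, is_derive t 1 (fun s => u_cbrt (s, cst 0 s)) 0) /\
  (* the Broad source, unique up to null sets along each characteristic *)
  broad_source (@flux R) u_cbrt \1_[set p : R * R | p.2 != 0] /\
  (forall g : R * R -> R, broad_source (@flux R) u_cbrt g ->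
     forall (I : interval R) (gamma : R -> R),
       characteristic (@flux R) u_cbrt I gamma ->
       {ae lebesgue_measure, forall t, t \in I ->
          g (t, gamma t) = \1_[set p : R * R | p.2 != 0] (t, gamma t)}) /\
  ~ broad_source (@flux R) u_cbrt (cst 1) /\
  lagrangian_parameterization (@flux R) u_cbrt `]-2, 2[ chi /\
  ~ lagrangian_source (@u_cbrt R) `]-2, 2[ chi (cst 1) /\
  (* the curves of chi in the half-plane x > 0, with y = 1 - tanh t0 *)
  (forall y : R, -2 < y < 2 ->
     (exists t, 0 < chi (t, y)) <-> (exists t0, y = 1 - tanh t0)) /\
  (forall t0 : R,
     0 < 1 - tanh t0 < 2 /\
     range (fun t => (t, chi (t, 1 - tanh t0))) `&` [set p | 0 < p.2] =
       [set (t0 + s, s ^+ 3) | s in [set s : R | 0 < s]]) /\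
  (* these are all the characteristic curves in that half-plane *)
  (forall (I : interval R) (gamma : R -> R),
     characteristic (@flux R) u_cbrt I gamma ->
     (forall t, t \in I -> 0 < gamma t) ->
     exists t0, forall t, t \in I -> t0 < t /\ gamma t = (t - t0) ^+ 3) /\
  (forall t0 : R,
     characteristic (@flux R) u_cbrt `]t0, +oo[ (fun t => (t - t0) ^+ 3) /\
     forall t, u_cbrt (t, (t - t0) ^+ 3) = cbrt ((t - t0) ^+ 3) /\
               cbrt ((t - t0) ^+ 3) = t - t0).
Proof.
split; first by move=> z; exact: (is_derive_exprn 3).
split; first by move=> p; exact: cbrt_cube.
split.
  move=> t x; split; first exact: (is_derive_cst (cbrt x) t 1).
  have -> : (fun z => flux (u_cbrt (t, z))) = id by apply/funext => z; exact: cbrt_cube.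
  exact: is_derive_id.
split; first exact: eulerian_source_1.
split; first exact: characteristic_0.
split; first by move=> t; exact: (is_derive_cst (cbrt 0) t 1).
split; first exact: broad_source_char.
split; first by move=> g bg I gamma; exact: broad_source_unique.
split.
  move=> [_ /(_ `]-oo, +oo[ _ (characteristic_0 _))].
  by rewrite interior_itv set_itvNyy; exact: not_distr_derive_0.
split; first exact: chi_lagrangian.
split.
  (* At y = 0 the curve of [chi] is the zero characteristic, along which 1 is already excluded. *)
  move=> [_ /(_ 0)]; rewrite in_itv/= => /(_ _); apply: contra_not (@not_distr_derive_0 R) => h.
  have : distr_derive setT (fun t : R => u_cbrt (t, chi (t, 0))) (fun=> 1) by apply: h; lra.
  by under eq_fun do rewrite chi0E.
split.
  move=> y y2; split=> [[t ct]|[t0 ->]]; last first.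
    (* One unit of time after departure the curve has reached height 1. *)
    by exists (t0 + 1); rewrite chi_tanh addrAC subrr add0r max_r// expr1n.
  have y0 : 0 < y by rewrite ltNge; apply/negP => /(chi_le0 t); rewrite leNgt ct.
  by exists (artanh (1 - y)); rewrite artanhK ?subKr//; lra.
split.
  move=> t0; split; first by have := tanh_itv t0; lra.
  apply/seteqP; split => [p [[t _ <-] /=]|p [s /= s0 <-]].
    rewrite chi_tanh; have [tt0|t0t] := leP t t0.
      by rewrite max_l ?subr_le0// expr0n ltxx.
    exists (t - t0); first by rewrite /= subr_gt0.
    by rewrite addrC subrK max_r// subr_ge0 ltW.
  split; last by rewrite /= exprn_gt0.
  by exists (t0 + s) => //; rewrite chi_tanh addrAC subrr add0r max_r// ltW.
split; first by move=> I gamma; exact: char_pos_cube.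
move=> t0; split.
  apply: (@characteristic_cube _ _ (fun t => t - t0)); first exact: continuous_subr.
  exact: is_derive_cube_subr.
by move=> t; split => //; exact: cube_cbrt.
Qed.
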